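(* Let $A\subseteq\omega$ be an infinite c.e. set. Then $\mathcal S^{(1)}_A$ has a positive computable numbering to which no Friedberg numbering can be reduced; that is, there is a positive computable numbering $\eta$ of $\mathcal S^{(1)}_A$ such that $\gamma\not\le_m\eta$ for every Friedberg numbering $\gamma$ of $\mathcal S^{(1)}_A$.
   Context: $\omega$ is the set of natural numbers; $\mathcal R^{(n)}$ is the set of total computable functions $\omega^n\to\omega$. $\langle\cdot,\cdot\rangle:\omega^2\to\omega$ is a computable bijection with $\langle x,y\rangle\ge x,y$. $\mathrm{Anf}^{(1)}_A$ is the set of partial functions from $\omega$ to $\omega$ whose domain is either empty or equal to $\{0,\dots,a-1\}$ for some $a\in A$, and $\mathcal S^{(1)}_A=\mathcal R^{(1)}\cup\mathrm{Anf}^{(1)}_A$. A numbering of a set $X$ is a surjection $\omega\to X$. A numbering $\eta$ of $\mathcal S^{(1)}_A$ is computable if the set $\{\langle\langle i,x\rangle,0\rangle:i,x\in\omega\}\cup\{\langle\langle i,x\rangle,\eta_i(x)+1\rangle:x\in\mathrm{dom}(\eta_i)\}$ is the range of a function in $\mathcal R^{(1)}$ (equivalently, the universal function $(i,x)\mapsto\eta_i(x)$ is partial computable). A Friedberg numbering is a one-to-one computable numbering. A numbering $\eta$ is positive if $\{\langle i,j\rangle:\eta_i=\eta_j\}$ is c.e. $\gamma\le_m\eta$ means that there is $g\in\mathcal R^{(1)}$ with $\gamma=\eta\circ g$. *)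

(* Defs.v *)
From mathcomp Require Import all_boot.
From mathcomp Require Import all_classical.

Set Implicit Arguments.
Unset Strict Implicit.
Unset Printing Implicit Defensive.

Local Open Scope classical_set_scope.

Inductive rec_scheme : nat -> Type :=
| RZero n : rec_scheme n
| RSucc : rec_scheme 1
| RProj n (i : 'I_n) : rec_scheme n
| RComp m n (f : rec_scheme m) (g : 'I_m -> rec_scheme n) : rec_scheme n
| RPrec n (f : rec_scheme n) (g : rec_scheme n.+2) : rec_scheme n.+1
| RMin n (f : rec_scheme n.+1) : rec_scheme n.

(* [rec_eval c v y]: the partial function given by [c] is defined at [v] with
   value [y].  Recursion is on the first argument, and [s k] is the value
   reached after k steps; [RMin f] is the least y with f (y, v) = 0, all
   smaller arguments being in the domain of f. *)
Fixpoint rec_eval n (c : rec_scheme n) : n.-tuple nat -> nat -> Prop :=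
  match c in rec_scheme n return n.-tuple nat -> nat -> Prop with
  | RZero _ => fun _ y => y = 0
  | RSucc => fun v y => y = (thead v).+1
  | RProj _ i => fun v y => y = tnth v i
  | RComp m _ f g => fun v y => exists w : m.-tuple nat,
      (forall i, rec_eval (g i) v (tnth w i)) /\ rec_eval f w y
  | RPrec _ f g => fun v y => exists s : nat -> nat,
      [/\ rec_eval f [tuple of behead v] (s 0),
          forall k, k < thead v ->
            rec_eval g [tuple of k :: s k :: behead v] (s k.+1)
        & y = s (thead v)]
  | RMin _ f => fun v y =>
      rec_eval f [tuple of y :: v] 0 /\
      (forall k, k < y -> exists z, rec_eval f [tuple of k :: v] z.+1)
  end.

Definition Rec n : set (n.-tuple nat -> nat) :=
  [set f | exists c : rec_scheme n, forall v y, rec_eval c v y <-> f v = y].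

Definition Rec1 : set (nat -> nat) :=
  [set f | Rec (fun v : 1.-tuple nat => f (tnth v ord0))].

Definition Rec2 : set (nat -> nat -> nat) :=
  [set f | Rec (fun v : 2.-tuple nat => f (tnth v ord0) (tnth v ord_max))].

Definition pairing_function (pr : nat -> nat -> nat) : Prop :=
  [/\ Rec2 pr,
      bijective (fun p : nat * nat => pr p.1 p.2)
    & forall x y, x <= pr x y /\ y <= pr x y].

Definition ce (A : set nat) : Prop :=
  A = set0 \/ exists2 f, Rec1 f & A = range f.

Definition pfun := nat -> option nat.

Definition pdom (p : pfun) : set nat := [set x | exists y, p x = Some y].

Definition Anf1 (A : set nat) : set pfun :=
  [set p | pdom p = set0 \/ exists2 a, A a & pdom p = [set x | x < a]].

Definition S1 (A : set nat) : set pfun :=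
  [set (fun x => Some (f x)) | f in Rec1] `|` Anf1 A.

Definition numbering (X : set pfun) (eta : nat -> pfun) : Prop :=
  range eta = X.

Definition computable_numbering (pr : nat -> nat -> nat) (X : set pfun)
    (eta : nat -> pfun) : Prop :=
  numbering X eta /\
  exists2 h, Rec1 h &
    range h = [set z | exists i x, z = pr (pr i x) 0] `|`
              [set z | exists i x y, eta i x = Some y /\ z = pr (pr i x) y.+1].

Definition friedberg_numbering (pr : nat -> nat -> nat) (X : set pfun)
    (eta : nat -> pfun) : Prop :=
  computable_numbering pr X eta /\ injective eta.

Definition positive_numbering (pr : nat -> nat -> nat)
    (eta : nat -> pfun) : Prop :=
  ce [set z | exists i j, eta i = eta j /\ z = pr i j].

Definition m_reducible (gamma eta : nat -> pfun) : Prop :=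
  exists2 g, Rec1 g & gamma = eta \o g.

(* Main.v *)
(* A numbering [gamma] with [gamma = eta \o g] of the same set as a positive numbering
   [eta] lets one find, for each [eta]-index, an equivalent [gamma]-index; if [gamma]
   is injective, equality of [eta]-indices becomes decidable.  So it suffices to
   build a positive computable numbering [eta] of [S1 A] with undecidable equality.

   Fix a sparse sequence of finite strings [special m] such that every string is a
   prefix of infinitely many of them.  The functions of [S1 A] that are not special are the
   limits of uniformly computable increasing sequences [alpha i] of strings.  Each
   index of [eta] follows some [alpha i] as long as [i] looks like the least index
   of its limit, and turns into a special string, thus known, once it does not.  As
   repetitions among the special strings are harmless in a positive numbering, no
   bookkeeping of used strings is needed.  Undecidability comes from indices that
   pass from [special (2n)] to [special (2n+1)] when [n] enters the halting set.

   The universal function searches for derivations, i.e. finite lists of judgments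
   each justified by other members of the list. *)
Require Import Defs.
From mathcomp Require Import all_boot.
From mathcomp Require Import all_classical.

Set Implicit Arguments.
Unset Strict Implicit.
Unset Printing Implicit Defensive.

Local Open Scope classical_set_scope.

(** * Closure properties of the recursive functions *)

Lemma Rec_const0 n : Rec (fun _ : n.-tuple nat => 0).
Proof. by exists (RZero n) => v y /=; split=> ->. Qed.

Lemma Rec_proj n (i : 'I_n) : Rec (fun v : n.-tuple nat => tnth v i).
Proof. by exists (RProj i) => v y /=; split=> ->. Qed.

Lemma Rec_comp m n (f : m.-tuple nat -> nat) (g : 'I_m -> n.-tuple nat -> nat) :
  Rec f -> (forall i, Rec (g i)) -> Rec (fun v => f [tuple g i v | i < m]).
Proof.
move=> [c cP] gR; have [d dP] := choice gR.
exists (RComp c d) => v y /=; split.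
- move=> [w [wP /cP <-]]; congr f; apply: eq_from_tnth => i.
  by rewrite tnth_mktuple; apply/dP.
- move=> <-; exists [tuple g i v | i < m]; split; last exact/cP.
  by move=> i; rewrite tnth_mktuple; apply/dP.
Qed.

Lemma Rec_succ n (f : n.-tuple nat -> nat) : Rec f -> Rec (fun v => (f v).+1).
Proof.
move=> fR.
have sR : Rec (fun v : 1.-tuple nat => (thead v).+1).
  by exists RSucc => v y /=; split=> ->.
have := Rec_comp sR (fun _ => fR); congr Rec; apply/funext => v.
by rewrite /thead tnth_mktuple.
Qed.

Lemma Rec_const n k : Rec (fun _ : n.-tuple nat => k).
Proof. by elim: k => [|k IH]; [exact: Rec_const0 | exact: (Rec_succ IH)]. Qed.

Lemma Rec_prec n (f : n.-tuple nat -> nat) (g : n.+2.-tuple nat -> nat)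
    (h : nat -> n.-tuple nat -> nat) :
    Rec f -> Rec g -> (forall v, h 0 v = f v) ->
    (forall k v, h k.+1 v = g [tuple of k :: h k v :: v]) ->
  Rec (fun v : n.+1.-tuple nat => h (thead v) [tuple of behead v]).
Proof.
move=> [c cP] [d dP] h0 hS; exists (RPrec c d) => v y /=; split.
- move=> [s [/cP s0 sS ->]].
  have H k : k <= thead v -> s k = h k [tuple of behead v].
    elim: k => [|k IH] lk; first by rewrite h0 s0.
    have /dP <- := sS _ lk; rewrite hS; congr g.
    by apply/val_inj => /=; rewrite IH // ltnW.
  by rewrite H.
- move=> <-; exists (fun k => h k [tuple of behead v]); split=> //.
  + exact/cP/esym/h0.
  + move=> k _; apply/dP; rewrite hS; congr g; exact/val_inj.
Qed.

Lemma Rec_min n (f : n.+1.-tuple nat -> nat) (g : n.-tuple nat -> nat) :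
    Rec f -> (forall v, f [tuple of g v :: v] = 0) ->
    (forall v k, k < g v -> f [tuple of k :: v] <> 0) -> Rec g.
Proof.
move=> [c cP] g0 gmin; exists (RMin c) => v y /=; split.
- move=> [/cP y0 ymin]; case: (ltngtP (g v) y) => // [lt|/gmin //].
  by have [z /cP] := ymin _ lt; rewrite g0.
- move=> <-; split; first exact/cP.
  move=> k /gmin k0; exists (f [tuple of k :: v]).-1.
  by apply/cP; case: (f _) k0.
Qed.

Lemma Rec1_id : Rec1 id.
Proof. exact: Rec_proj. Qed.

Lemma Rec1_comp n f (g : n.-tuple nat -> nat) :
  Rec1 f -> Rec g -> Rec (fun v => f (g v)).
Proof.
move=> fR gR; have := Rec_comp fR (fun _ => gR); congr Rec; apply/funext => v.
by rewrite tnth_mktuple.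
Qed.

Lemma Rec2_comp n op (f g : n.-tuple nat -> nat) :
  Rec2 op -> Rec f -> Rec g -> Rec (fun v => op (f v) (g v)).
Proof.
move=> opR fR gR.
have H (i : 'I_2) : Rec (if i == ord0 then f else g) by case: ifP.
have := Rec_comp opR H; congr Rec; apply/funext => v.
by rewrite !tnth_mktuple.
Qed.

Lemma Rec2_flip op : Rec2 op -> Rec2 (fun x y => op y x).
Proof. by move=> opR; apply: Rec2_comp opR (Rec_proj _) (Rec_proj _). Qed.

Lemma Rec2_prec f (g : nat -> nat -> nat -> nat) h :
    Rec1 f ->
    Rec (fun v : 3.-tuple nat =>
      g (tnth v ord0) (tnth v (inord 1)) (tnth v (inord 2))) ->
    (forall x, h 0 x = f x) -> (forall k x, h k.+1 x = g k (h k x) x) ->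
  Rec2 h.
Proof.
move=> fR gR h0 hS.
have := @Rec_prec 1 _ _ (fun k v => h k (tnth v ord0)) fR gR.
move=> /(_ (fun v => h0 _)) /(_ _); case.
  by move=> k v; rewrite hS !(tnth_nth 0) !inordK.
move=> c cP; exists c => v y; rewrite cP /thead.
have -> : tnth [tuple of behead v] ord0 = tnth v ord_max.
  by rewrite !(tnth_nth 0) /= nth_behead.
by [].
Qed.

Lemma Rec2_add : Rec2 addn.
Proof.
apply: (@Rec2_prec id (fun _ u _ => u.+1)) => //; first exact: Rec1_id.
apply: Rec_succ; exact: Rec_proj.
Qed.

Lemma Rec1_pred : Rec1 predn.
Proof.
have H : Rec2 (fun k _ => k.-1).
  apply: (@Rec2_prec (fun=> 0) (fun k _ _ => k)) => //; first exact: Rec_const.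
  exact: Rec_proj.
exact: (Rec2_comp H (Rec_proj (@ord0 0)) (Rec_proj ord0)).
Qed.

Lemma Rec2_sub : Rec2 subn.
Proof.
apply: (Rec2_flip (op := fun k x => x - k)).
apply: (@Rec2_prec id (fun _ u _ => u.-1)); first exact: Rec1_id.
- apply: Rec1_comp Rec1_pred _; exact: Rec_proj.
- by move=> x; rewrite subn0.
- by move=> k x; rewrite subnS.
Qed.

Lemma Rec2_mul : Rec2 muln.
Proof.
apply: (@Rec2_prec (fun=> 0) (fun _ u x => x + u)) => //; first exact: Rec_const.
exact: (Rec2_comp Rec2_add (Rec_proj _) (Rec_proj _)).
Qed.

(** [p z] is the least [x] with [op x y = z] for some [y]. As [y <= op x y], the search for [y] is
    bounded by [z], and it is expressed by the vanishing of a product of distances; one minimization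
    over [x] remains. *)
Lemma Rec1_inverse op p q :
    Rec2 op -> (forall x y, y <= op x y) -> (forall z, op (p z) (q z) = z) ->
    (forall x y, p (op x y) = x) -> Rec1 p.
Proof.
move=> opR ley opK pK.
pose d x y := (x - y) + (y - x).
have d0 x y : (d x y == 0) = (x == y) by rewrite addn_eq0 !subn_eq0 -eqn_leq.
have dR : Rec2 d.
  by apply: Rec2_comp Rec2_add _ _; [|apply: Rec2_flip]; exact: Rec2_sub.
pose acc := fix acc k (v : 2.-tuple nat) := if k is k'.+1 then
  acc k' v * d (op (tnth v ord0) k') (tnth v ord_max) else 1.
have acc0 k v :
    acc k v = 0 <-> exists2 y, y < k & op (tnth v ord0) y = tnth v ord_max.
  elim: k => [|k IH] /=; first by split=> // -[].
  split.
    move/eqP; rewrite muln_eq0 => /orP[/eqP/IH[y yk yP]|].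
      by exists y => //; apply: ltnW.
    by rewrite d0 => /eqP <-; exists k.
  move=> [y]; rewrite ltnS leq_eqVlt => /orP[/eqP-> yP|yk yP].
    by apply/eqP; rewrite muln_eq0 d0 yP eqxx orbT.
  by have -> : acc k v = 0 by apply/IH; exists y.
have accR : Rec (fun v : 3.-tuple nat => acc (thead v) [tuple of behead v]).
  apply: (@Rec_prec 2 (fun=> 1) (fun w => tnth w (inord 1) *
     d (op (tnth w (inord 2)) (tnth w (inord 0))) (tnth w (inord 3)))) => //.
  - exact: Rec_const.
  - apply: Rec2_comp Rec2_mul _ _; first exact: Rec_proj.
    apply: Rec2_comp dR _ _; last exact: Rec_proj.
    by apply: Rec2_comp opR _ _; apply: Rec_proj.
  - by move=> k v /=; rewrite !(tnth_nth 0) !inordK.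
(* Here [v] holds a candidate [x] and the number [z]; the bound [z.+1] admits every possible
   [y <= z]. *)
have gR : Rec (fun v : 2.-tuple nat => acc (tnth v ord_max).+1 v).
  pose args (i : 'I_3) : 2.-tuple nat -> nat :=
    if i == inord 0 then fun v => (tnth v ord_max).+1
    else if i == inord 1 then fun v => tnth v ord0 else fun v => tnth v ord_max.
  have := Rec_comp accR (g := args); rewrite /args; case.
    move=> i; do 2?case: ifP => _; [apply: Rec_succ| |]; exact: Rec_proj.
  move=> c cP; exists c => v y; rewrite cP /thead tnth_mktuple /= -val_eqE /= inordK //=.
  suff -> : [tuple of behead [tuple args i v | i < 3]] = v by [].
  apply: eq_from_tnth => i; rewrite tnth_behead tnth_mktuple /args -!val_eqE /=.
  rewrite !inordK //; last by rewrite ltnS ltn_ord.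
  by case: i => -[|[|]] //= i; rewrite !(tnth_nth 0).
apply: Rec_min gR _ _ => v.
  apply/acc0; exists (q (tnth v ord0)); rewrite !(tnth_nth 0) /= ?opK //.
  by rewrite ltnS -{2}(opK (nth 0 v 0)).
move=> k lt /acc0 [y _]; rewrite !(tnth_nth 0) /= => E.
by move: lt; rewrite (tnth_nth 0) /= -E pK ltnn.
Qed.

(** * Computable functions between coded types *)

(** Every positive integer is uniquely a power of 2 times an odd number. Data are coded with this
    fixed pairing; the given [pr] enters only where numberings are enumerated. *)
Definition npair x y := (2 ^ x * y.*2.+1).-1.
Definition nfst z := logn 2 z.+1.
Definition nsnd z := (z.+1 %/ 2 ^ nfst z)./2.

Arguments npair : simpl never.
Arguments nfst : simpl never.
Arguments nsnd : simpl never.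

Lemma npairS x y : (npair x y).+1 = 2 ^ x * y.*2.+1.
Proof. by rewrite prednK // muln_gt0 expn_gt0. Qed.

Lemma nfstK x y : nfst (npair x y) = x.
Proof.
rewrite /nfst npairS lognM ?expn_gt0 // pfactorK // logn_coprime ?addn0 //.
by rewrite coprime2n /= odd_double.
Qed.

Lemma nsndK x y : nsnd (npair x y) = y.
Proof. by rewrite /nsnd nfstK npairS mulKn ?expn_gt0 //= uphalf_double. Qed.

Lemma npairK z : npair (nfst z) (nsnd z) = z.
Proof.
have [x [y ->]] : exists x y, z = npair x y; last by rewrite nfstK nsndK.
have [m m2 zE] := pfactor_coprime (isT : prime 2) (ltn0Sn z).
exists (logn 2 z.+1), m./2; apply/eqP.
rewrite -eqSS npairS {1}zE mulnC -[_.*2.+1]/(true + _).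
by rewrite -[true](_ : odd m = true) ?odd_double_half // -coprime2n.
Qed.

Lemma npair_ge2 x y : y <= npair x y.
Proof.
rewrite -ltnS npairS (@leq_trans (1 * y.*2.+1)) ?leq_mul2r ?expn_gt0 ?orbT //.
by rewrite mul1n ltnS -addnn leq_addr.
Qed.

Lemma npair_ge1 x y : x <= npair x y.
Proof.
rewrite -ltnS npairS (@leq_trans (2 ^ x * 1)) ?leq_mul2l ?orbT //.
by rewrite muln1 ltn_expl.
Qed.

Lemma Rec2_npair : Rec2 npair.
Proof.
have expR : Rec2 (fun x _ : nat => 2 ^ x).
  apply: (@Rec2_prec (fun=> 1) (fun _ u _ => u + u)) => //.
  - exact: Rec_const.
  - by apply: Rec2_comp Rec2_add _ _; apply: Rec_proj.
  - by move=> k x; rewrite addnn -mul2n expnS.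
apply: Rec1_comp Rec1_pred _; apply: Rec2_comp Rec2_mul _ _.
  exact: (Rec2_comp expR (Rec_proj ord0) (Rec_proj ord0)).
have -> : (fun v : 2.-tuple nat => (tnth v ord_max).*2.+1) =
          (fun v => (tnth v ord_max + tnth v ord_max).+1).
  by apply/funext => v; rewrite addnn.
by apply: Rec_succ; apply: Rec2_comp Rec2_add _ _; apply: Rec_proj.
Qed.

Lemma Rec1_nfst : Rec1 nfst.
Proof. exact: Rec1_inverse Rec2_npair npair_ge2 npairK nfstK. Qed.

Lemma Rec1_nsnd : Rec1 nsnd.
Proof.
apply: Rec1_inverse (Rec2_flip Rec2_npair) _ npairK _ => x y.
  exact: npair_ge1.
exact: nsndK.
Qed.

(** Codings are bijections: each number is the code of something, so decoding is total and a search
    over numbers is a search over [T]. *)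
Class coded (T : Type) := Coded {
  enc : T -> nat;
  dec : nat -> T;
  encK : cancel enc dec;
  decK : cancel dec enc }.

#[global] Hint Mode coded ! : typeclass_instances.

#[global] Instance coded_nat : coded nat :=
  @Coded nat id id (fun=> erefl) (fun=> erefl).

Section CodedProd.
Context (T U : Type) {cT : coded T} {cU : coded U}.

Let enc_prod (p : T * U) := npair (enc p.1) (enc p.2).
Let dec_prod n : T * U := (dec (nfst n), dec (nsnd n)).

Fact enc_prodK : cancel enc_prod dec_prod.
Proof. by case=> x y; rewrite /enc_prod /dec_prod nfstK nsndK !encK. Qed.

Fact dec_prodK : cancel dec_prod enc_prod.
Proof. by move=> n; rewrite /enc_prod /dec_prod /= !decK npairK. Qed.

#[global] Instance coded_prod : coded (T * U) := Coded enc_prodK dec_prodK.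
End CodedProd.

Section CodedSeq.
Context (T : Type) {cT : coded T}.

Fixpoint enc_seq (s : seq T) :=
  if s is x :: s' then (npair (enc x) (enc_seq s')).+1 else 0.

(** The fuel [k] makes the recursion structural. Any [k >= n] is enough, since the code of the tail
    is smaller than the code of the list. *)
Fixpoint dec_fuel k n : seq T :=
  if k is k'.+1 then
    if n is n'.+1 then dec (nfst n') :: dec_fuel k' (nsnd n') else [::]
  else [::].

Let dec_seq n := dec_fuel n n.

Fact enc_fuelK k n : n <= k -> enc_seq (dec_fuel k n) = n.
Proof.
elim: k n => [|k IH] [|n] //= le_nk; rewrite decK IH ?npairK //.
by rewrite -ltnS; apply: leq_trans le_nk; rewrite ltnS -{2}(npairK n) npair_ge2.
Qed.

Fact enc_seqI : injective enc_seq.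
Proof.
elim=> [|x s IH] [|y s'] //= [] E.
have := congr1 nsnd E; rewrite !nsndK => /IH ->.
by have := congr1 nfst E; rewrite !nfstK => /(congr1 (@dec T cT));
  rewrite !encK => ->.
Qed.

Fact dec_seqK : cancel dec_seq enc_seq.
Proof. by move=> n; apply: enc_fuelK. Qed.

Fact enc_seqK : cancel enc_seq dec_seq.
Proof. by move=> s; apply: enc_seqI; rewrite dec_seqK. Qed.

#[global] Instance coded_seq : coded (seq T) := Coded enc_seqK dec_seqK.
End CodedSeq.

Definition computable (T U : Type) {cT : coded T} {cU : coded U} (f : T -> U) :=
  Rec1 (fun n => enc (f (dec n))).

Definition decid (T : Type) {cT : coded T} (P : T -> bool) :=
  computable (fun t => nat_of_bool (P t)).

Lemma computableP f : computable f <-> Rec1 f.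
Proof. by []. Qed.

Lemma Rec_computable (T U : Type) {cT : coded T} {cU : coded U} n (f : T -> U)
    (h : n.-tuple nat -> nat) :
  computable f -> Rec h -> Rec (fun v => enc (f (dec (h v)))).
Proof. exact: (@Rec1_comp _ (fun k => enc (f (dec k)))). Qed.

Section Closure.
Context (T U V : Type) {cT : coded T} {cU : coded U} {cV : coded V}.

Lemma computable_id : computable (fun t : T => t).
Proof.
rewrite /computable; have -> : (fun n => enc (dec n : T)) = id.
  by apply/funext => n; rewrite decK.
exact: Rec1_id.
Qed.

Lemma computable_ext (f g : T -> U) :
  f =1 g -> computable f -> computable g.
Proof. by move=> /funext->. Qed.

Lemma computable_const (u : U) : computable (fun _ : T => u).
Proof. exact: Rec_const. Qed.

Lemma computable_comp (g : U -> V) (f : T -> U) :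
  computable g -> computable f -> computable (fun t => g (f t)).
Proof.
rewrite /computable => gR fR.
have := Rec1_comp gR (g := fun v : 1.-tuple nat => enc (f (dec (tnth v ord0)))) fR.
by congr Rec; apply/funext => v; rewrite encK.
Qed.

Lemma computable_enc (f : T -> U) :
  computable f -> computable (fun t => enc (f t)).
Proof. by []. Qed.

Lemma computable_dec (f : T -> nat) :
  computable f -> computable (fun t => dec (f t) : U).
Proof.
rewrite /computable /Rec1 /=; congr Rec; apply/funext => v; by rewrite decK.
Qed.

Lemma computable_encP (f : T -> U) :
  computable (fun t => enc (f t)) -> computable f.
Proof. by []. Qed.

Lemma computable_pair (f : T -> U) (g : T -> V) :
  computable f -> computable g -> computable (fun t => (f t, g t)).
Proof. exact: Rec2_comp Rec2_npair. Qed.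

Lemma computable_Rec1 op (f : T -> nat) :
  Rec1 op -> computable f -> computable (fun t => op (f t)).
Proof. exact: Rec1_comp. Qed.

Lemma computable_Rec2 op (f g : T -> nat) :
  Rec2 op -> computable f -> computable g ->
  computable (fun t => op (f t) (g t)).
Proof. exact: Rec2_comp. Qed.

End Closure.

Section Projections.
Context (T U V : Type) {cT : coded T} {cU : coded U} {cV : coded V}.

Lemma computable_fst (f : T -> U * V) :
  computable f -> computable (fun t => (f t).1).
Proof.
move=> fR; have := computable_Rec1 Rec1_nfst (computable_enc fR).
by congr Rec; apply/funext => v; rewrite nfstK.
Qed.

Lemma computable_snd (f : T -> U * V) :
  computable f -> computable (fun t => (f t).2).
Proof.
move=> fR; have := computable_Rec1 Rec1_nsnd (computable_enc fR).
by congr Rec; apply/funext => v; rewrite nsndK.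
Qed.

Lemma computable_nfst (f : T -> nat) :
  computable f -> computable (fun t => nfst (f t)).
Proof. exact: computable_Rec1 Rec1_nfst. Qed.

Lemma computable_nsnd (f : T -> nat) :
  computable f -> computable (fun t => nsnd (f t)).
Proof. exact: computable_Rec1 Rec1_nsnd. Qed.

Lemma computable_npair (f g : T -> nat) :
  computable f -> computable g -> computable (fun t => npair (f t) (g t)).
Proof. exact: computable_Rec2 Rec2_npair. Qed.

Lemma computable_succ (f : T -> nat) :
  computable f -> computable (fun t => (f t).+1).
Proof. exact: Rec_succ. Qed.

End Projections.

Lemma computable_fst0 (T U : Type) {cT : coded T} {cU : coded U} :
  computable (@fst T U).
Proof. exact: computable_fst (computable_id (T := T * U)). Qed.

Lemma computable_snd0 (T U : Type) {cT : coded T} {cU : coded U} :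
  computable (@snd T U).
Proof. exact: computable_snd (computable_id (T := T * U)). Qed.


Fixpoint natrec (U : Type) (u : U) (g : nat -> U -> U) n :=
  if n is k.+1 then g k (natrec u g k) else u.

Section Recursion.
Context (T U : Type) {cT : coded T} {cU : coded U}.

Lemma computable_natrec (f : T -> U) (g : T * nat * U -> U) (n : T -> nat) :
    computable f -> computable g -> computable n ->
  computable (fun t => natrec (f t) (fun k u => g (t, k, u)) (n t)).
Proof.
move=> fR gR nR.
pose h k x :=
  @enc U cU (natrec (f (@dec T cT x)) (fun k u => g (@dec T cT x, k, u)) k).
suff hR : Rec2 h.
  apply: computable_encP.
  have := computable_Rec2 hR nR (computable_enc (computable_id (T := T))).
  by apply: computable_ext => t; rewrite /h encK.
apply: (@Rec2_prec _ (fun k u x => enc (g (dec x, k, dec u))) h fR) => //;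
  last first.
  by move=> k x; rewrite /h /= encK.
have := Rec_computable gR (Rec2_comp Rec2_npair (Rec2_comp Rec2_npair
  (Rec_proj (inord 2)) (Rec_proj (@ord0 2))) (Rec_proj (inord 1))).
by congr Rec; apply/funext => v /=; rewrite !(nfstK, nsndK).
Qed.

Lemma computable_iter (f : T -> U) (g : T * U -> U) (n : T -> nat) :
    computable f -> computable g -> computable n ->
  computable (fun t => iter (n t) (fun u => g (t, u)) (f t)).
Proof.
move=> fR gR nR.
have := computable_natrec fR (g := fun p => g (p.1.1, p.2)) _ nR.
case.
  apply: (computable_comp gR); apply: computable_pair.
    by do 2!apply: computable_fst; apply: computable_id.
  by apply: computable_snd; apply: computable_id.
move=> c cP; exists c => v y; rewrite cP; set t := dec _.
suff -> k : natrec (f t) (fun k u => g (t, u)) k =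
    iter k (fun u => g (t, u)) (f t) by [].
by elim: k => //= k ->.
Qed.

Lemma computable_min (P : T * nat -> bool) (f : T -> nat) :
    decid P -> (forall t, P (t, f t)) -> (forall t k, k < f t -> ~~ P (t, k)) ->
  computable f.
Proof.
move=> PR Pf Pmin.
(* Minimization looks for a zero, so truth of [P] is turned into the value 0. *)
have H : Rec (fun v : 2.-tuple nat => 1 - P (dec (tnth v ord_max), tnth v ord0)).
  apply: Rec2_comp Rec2_sub (Rec_const _ _) _.
  have := Rec_computable PR
    (Rec2_comp Rec2_npair (Rec_proj ord_max) (Rec_proj (@ord0 1))).
  by congr Rec; apply/funext => v /=; rewrite !(nfstK, nsndK).
apply: Rec_min H _ _ => [v|v k].
  by rewrite !(tnth_nth 0) /= Pf.
by move/Pmin; rewrite !(tnth_nth 0) /= => /negPf->.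
Qed.

(** An unbounded search through the codes of values stops exactly at [enc (f t)], because [P (t, _)]
    holds of one value only. This handles functions that are easier to check than to compute by
    recursion. *)
Lemma computable_graph (P : T * U -> bool) (f : T -> U) :
  decid P -> (forall t u, P (t, u) <-> u = f t) -> computable f.
Proof.
move=> PR Pf; apply: computable_encP.
apply: (@computable_min (fun p => P (p.1, dec p.2))).
- apply: (computable_comp PR); apply: computable_pair.
    by apply: computable_fst; apply: computable_id.
  by apply: computable_dec; apply: computable_snd; apply: computable_id.
- by move=> t /=; rewrite encK; apply/Pf.
- move=> t k lt /=; apply/negP => /Pf E.
  by move: lt; rewrite -E decK ltnn.
Qed.

End Recursion.

Section Predicates.
Context (T : Type) {cT : coded T}.
Implicit Types (f g : T -> nat) (P Q : T -> bool).

Lemma computable_add f g :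
  computable f -> computable g -> computable (fun t => f t + g t).
Proof. exact: computable_Rec2 Rec2_add. Qed.

Lemma computable_sub f g :
  computable f -> computable g -> computable (fun t => f t - g t).
Proof. exact: computable_Rec2 Rec2_sub. Qed.

Lemma computable_mul f g :
  computable f -> computable g -> computable (fun t => f t * g t).
Proof. exact: computable_Rec2 Rec2_mul. Qed.

Lemma decid_ext P Q : P =1 Q -> decid P -> decid Q.
Proof. by move=> /funext->. Qed.

Lemma decid_neg P : decid P -> decid (fun t => ~~ P t).
Proof.
move=> PR; have := computable_sub (computable_const 1) PR.
by apply: computable_ext => t; case: (P t).
Qed.

Lemma decid_and P Q : decid P -> decid Q -> decid (fun t => P t && Q t).
Proof.
move=> PR QR; have := computable_mul PR QR.
by apply: computable_ext => t; case: (P t); case: (Q t).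
Qed.

Lemma decid_or P Q : decid P -> decid Q -> decid (fun t => P t || Q t).
Proof.
move=> PR QR; have := decid_neg (decid_and (decid_neg PR) (decid_neg QR)).
by apply: decid_ext => t; rewrite negb_and !negbK.
Qed.

Lemma decid_leq f g : computable f -> computable g -> decid (fun t => f t <= g t).
Proof.
move=> fR gR; have := computable_sub (computable_const 1) (computable_sub fR gR).
apply: computable_ext => t; rewrite -[_ <= _]/(_ - _ == 0).
by case: (f t - g t).
Qed.

Lemma decid_eq (U : eqType) {cU : coded U} (f g : T -> U) :
  computable f -> computable g -> decid (fun t => f t == g t).
Proof.
move=> fR gR; have := decid_and
  (decid_leq (f := fun t => enc (f t)) (g := fun t => enc (g t)) fR gR)
  (decid_leq (f := fun t => enc (g t)) (g := fun t => enc (f t)) gR fR).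
by apply: decid_ext => t; rewrite -eqn_leq (can_eq encK).
Qed.

Lemma computable_if (U : Type) {cU : coded U} P (f g : T -> U) :
  decid P -> computable f -> computable g ->
  computable (fun t => if P t then f t else g t).
Proof.
move=> PR fR gR; apply: computable_encP.
have := computable_add
  (computable_mul PR (computable_enc fR))
  (computable_mul (decid_neg PR) (computable_enc gR)).
apply: computable_ext => t.
by case: (P t); rewrite !(mul0n, mul1n, addn0, add0n).
Qed.

Lemma decid_if b P Q : decid b -> decid P -> decid Q ->
  decid (fun t => if b t then P t else Q t).
Proof.
move=> bR PR QR; have := computable_if bR PR QR.
by apply: computable_ext => t; case: (b t).
Qed.

End Predicates.

Section BoundedQuantifiers.
Context (T : Type) {cT : coded T}.
Implicit Types (f : T -> nat).

Lemma decid_all (P : T -> nat -> bool) f :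
  decid (fun p => P p.1 p.2) -> computable f ->
  decid (fun t => all (P t) (iota 0 (f t))).
Proof.
move=> PR fR.
have := computable_natrec (f := fun=> 1) (g := fun p => p.2 * P p.1.1 p.1.2) _ _ fR.
case.
- exact (computable_const _).
- apply: computable_mul; first by apply: computable_snd; apply: computable_id.
  apply: (computable_comp PR); apply: computable_fst; apply: computable_id.
move=> c cP; exists c => v y; rewrite cP /=; set t : T := dec _.
suff -> k : natrec 1 (fun k u => u * P t k) k = all (P t) (iota 0 k) by [].
elim: k => // k IH; rewrite -[in RHS]addn1 iotaD all_cat /= IH andbT add0n.
by case: (all _ _); case: (P t k).
Qed.

Lemma decid_has (P : T -> nat -> bool) f :
  decid (fun p => P p.1 p.2) -> computable f ->
  decid (fun t => has (P t) (iota 0 (f t))).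
Proof.
move=> PR fR.
have := decid_neg (@decid_all (fun t k => ~~ P t k) f (decid_neg PR) fR).
by apply: decid_ext => t; rewrite -has_predC; apply: eq_has => k; rewrite /= negbK.
Qed.

End BoundedQuantifiers.

(** * Computability of operations on sequences *)

Section Sequences.
Context (T : Type) {cT : coded T}.

Lemma computable_cons (U : Type) {cU : coded U} (f : T -> U) (g : T -> seq U) :
  computable f -> computable g -> computable (fun t => f t :: g t).
Proof. by move=> fR gR; apply: Rec_succ; apply: Rec2_comp Rec2_npair fR gR. Qed.

Lemma computable_behead (U : Type) {cU : coded U} (f : T -> seq U) :
  computable f -> computable (fun t => behead (f t)).
Proof.
move=> fR; apply: computable_encP.
(* The empty list has code 0, and any other code is the successor of a pair, so a predecessor and a
   projection take the list apart. *)
have := computable_if (decid_eq (computable_enc fR) (computable_const 0))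
  (computable_const 0)
  (computable_nsnd (computable_Rec1 Rec1_pred (computable_enc fR))).
by apply: computable_ext => t /=; case: (f t) => //= x s; rewrite nsndK.
Qed.

Lemma computable_head (U : Type) {cU : coded U} (x : U) (f : T -> seq U) :
  computable f -> computable (fun t => head x (f t)).
Proof.
move=> fR; apply: computable_encP.
have := computable_if (decid_eq (computable_enc fR) (computable_const 0))
  (computable_const (@enc U cU x))
  (computable_nfst (computable_Rec1 Rec1_pred (computable_enc fR))).
by apply: computable_ext => t /=; case: (f t) => //= y s; rewrite nfstK.
Qed.

End Sequences.

Lemma computable_drop (T : Type) {cT : coded T} (U : Type) {cU : coded U}
    (n : T -> nat) (f : T -> seq U) :
  computable n -> computable f -> computable (fun t => drop (n t) (f t)).
Proof.
move=> nR fR.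
have := computable_iter (g := fun p => behead p.2) fR _ nR.
case; first by apply: computable_behead; apply: computable_snd;
  apply: computable_id.
move=> c cP; exists c => v y; rewrite cP; set t := dec _.
suff -> k : iter k behead (f t) = drop k (f t) by [].
by elim: k => [|k IH] /=; rewrite ?drop0 // IH -drop1 drop_drop add1n.
Qed.

Lemma computable_nth (T : Type) {cT : coded T} (U : Type) {cU : coded U} (x : U)
    (n : T -> nat) (f : T -> seq U) :
  computable n -> computable f -> computable (fun t => nth x (f t) (n t)).
Proof.
move=> nR fR; have := computable_head x (computable_drop nR fR).
by apply: computable_ext => t; rewrite -nth0 nth_drop addn0.
Qed.

Lemma computable_size (T : Type) {cT : coded T} (U : Type) {cU : coded U}
    (f : T -> seq U) :
  computable f -> computable (fun t => size (f t)).
Proof.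
(* The size is the least number of entries whose removal leaves the list with code 0. *)
move=> fR; apply: (@computable_min _ _ (fun p => enc (drop p.2 (f p.1)) == 0)).
- apply: decid_eq (computable_const _); apply: computable_enc;
    apply: computable_drop.
    by apply: computable_snd; apply: computable_id.
  by apply: (computable_comp fR); apply: computable_fst; apply: computable_id.
- by move=> t /=; rewrite drop_size.
- move=> t k /=; rewrite -subn_gt0 -size_drop /=.
  by case: (drop _ _).
Qed.

(** * Syntax-directed proofs of computability and decidability *)

Ltac computes_step := first
  [ assumption
  | simple apply computable_const
  | simple apply computable_id
  | simple apply computable_fst0
  | simple apply computable_snd0
  | match goal with H : @computable _ _ _ _ ?f
      |- @computable _ _ _ _ (fun s => ?f (@?a s)) =>
      refine (computable_comp (f := a) H _) end
  | match goal with H : @decid _ _ ?P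
      |- @decid _ _ (fun s => ?P (@?a s)) =>
      refine (computable_comp (g := fun s => nat_of_bool (P s)) (f := a) H _) end
  | simple apply computable_pair
  | match goal with |- computable (fun t => (@?f t).1) =>
      refine (computable_fst (f := f) _) end
  | match goal with |- computable (fun t => (@?f t).2) =>
      refine (computable_snd (f := f) _) end
  | simple apply computable_succ
  | simple apply computable_nfst
  | simple apply computable_nsnd
  | simple apply computable_npair
  | simple apply computable_add
  | simple apply computable_sub
  | simple apply computable_mul
  | simple apply computable_cons
  | simple apply computable_behead
  | simple apply computable_head
  | simple apply computable_drop
  | simple apply computable_nth
  | match goal with |- computable (fun t => size (@?f t)) =>
      refine (computable_size (f := f) _) end
  | simple apply decid_neg
  | simple apply decid_and
  | simple apply decid_or
  | simple apply decid_leq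
  | match goal with |- @decid ?T ?cT (fun t => @eq_op ?E (@?a t) (@?b t)) =>
      let U := eval simpl in (Equality.sort E) in
      let c := constr:(ltac:(typeclasses eauto) : coded U) in
      refine ((@decid_eq T cT E c : forall f g : T -> U,
        @computable T U cT c f -> @computable T U cT c g ->
        @decid T cT (fun t => @eq_op E (f t) (g t))) a b _ _) end
  | simple apply decid_if
  | simple apply computable_if
  | simple apply decid_all
  | simple apply decid_has
  | match goal with |- computable (fun t => enc (@?f t)) =>
      refine (computable_enc (f := f) _) end
  | simple apply computable_dec ].

Ltac computes := repeat computes_step.

Lemma decid_mem (T : Type) {cT : coded T} (U : eqType) {cU : coded U}
    (f : T -> U) (g : T -> seq U) :
  computable f -> computable g -> decid (fun t => f t \in g t).
Proof.
move=> fR gR.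
(* Comparing whole tails says that entry [k] is [f t] without using a default entry. *)
have : decid (fun t => has (fun k => drop k (g t) == f t :: drop k.+1 (g t))
    (iota 0 (size (g t)))).
  by computes.
apply: decid_ext => t; apply/hasP/idP => [[k]|/(nthP (f t)) [k lt_k E]].
  rewrite mem_iota /= => lt_k; rewrite (drop_nth (f t)) // => /eqP [<-].
  exact: mem_nth.
by exists k; rewrite ?mem_iota // (drop_nth (f t)) // E.
Qed.

Lemma prefix_nth (T : eqType) (x : T) (s t : seq T) :
  prefix s t = (size s <= size t) &&
    all (fun k => nth x s k == nth x t k) (iota 0 (size s)).
Proof.
apply/idP/andP => [/prefixP [u ->]|[le_st /allP E]].
  split; first by rewrite size_cat leq_addr.
  by apply/allP => k; rewrite mem_iota nth_cat => /= ->.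
apply/prefixP; exists (drop (size s) t).
rewrite -{1}(cat_take_drop (size s) t); congr (_ ++ _).
apply: (eq_from_nth (x0 := x)); rewrite size_takel // => k lt_k.
by rewrite nth_take //; apply/esym/eqP/E; rewrite mem_iota.
Qed.

Lemma decid_prefix (T : Type) {cT : coded T} (U : eqType) {cU : coded U}
    (f g : T -> seq U) :
  computable f -> computable g -> decid (fun t => prefix (f t) (g t)).
Proof.
move=> fR gR.
pose x := @dec U cU 0.
have : decid (fun t => (size (f t) <= size (g t)) &&
    all (fun k => nth x (f t) k == nth x (g t) k) (iota 0 (size (f t)))).
  by computes.
by apply: decid_ext => t; rewrite -prefix_nth.
Qed.

Lemma computable_mkseq (T : Type) {cT : coded T} (U : Type) {cU : coded U}
    (f : T -> nat -> U) (n : T -> nat) :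
  computable (fun p => f p.1 p.2) -> computable n ->
  computable (fun t => mkseq (f t) (n t)).
Proof.
move=> fR nR; pose x := @dec U cU 0.
apply: (@computable_graph _ _ _ _ (fun p => (size p.2 == n p.1) &&
   all (fun k => enc (nth x p.2 k) == enc (f p.1 k)) (iota 0 (n p.1)))).
  by computes; apply: (computable_comp fR (computable_pair _ _)); computes.
move=> t u /=; split.
  move=> /andP [/eqP sz /allP E]; apply: (eq_from_nth (x0 := x)).
    by rewrite size_mkseq.
  move=> k; rewrite sz => lt_k; rewrite nth_mkseq //.
  by apply/(can_inj encK)/eqP/E; rewrite mem_iota.
move=> ->; rewrite size_mkseq eqxx; apply/allP => k; rewrite mem_iota /= => lt_k.
by rewrite nth_mkseq.
Qed.

Lemma computable_take (T : Type) {cT : coded T} (U : Type) {cU : coded U}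
    (n : T -> nat) (f : T -> seq U) :
  computable n -> computable f -> computable (fun t => take (n t) (f t)).
Proof.
move=> nR fR; pose x := @dec U cU 0.
have : computable (fun t => mkseq (fun k => nth x (f t) k)
    (if n t <= size (f t) then n t else size (f t))).
  by apply: computable_mkseq; computes.
apply: computable_ext => t; case: leqP => [le_n|lt_n].
  apply: (eq_from_nth (x0 := x)); first by rewrite size_mkseq size_takel.
  by move=> k; rewrite size_mkseq => lt_k; rewrite nth_mkseq // nth_take.
by rewrite mkseq_nth take_oversize // ltnW.
Qed.

Section SequenceQuantifiers.
Context (T : Type) {cT : coded T} (U : Type) {cU : coded U}.
Variables (P : T -> U -> bool) (s : T -> seq U).
Hypotheses (PR : decid (fun p => P p.1 p.2)) (sR : computable s).

Lemma decid_has_seq : decid (fun t => has (P t) (s t)).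
Proof.
pose x := @dec U cU 0.
have : decid (fun t => has (fun k => P t (nth x (s t) k)) (iota 0 (size (s t)))).
  computes; apply: (computable_comp PR (computable_pair _ _)); computes.
by apply: decid_ext => t; rewrite -[in RHS](mkseq_nth x (s t)) has_map.
Qed.

Lemma decid_all_seq : decid (fun t => all (P t) (s t)).
Proof.
pose x := @dec U cU 0.
have : decid (fun t => all (fun k => P t (nth x (s t) k)) (iota 0 (size (s t)))).
  computes; apply: (computable_comp PR (computable_pair _ _)); computes.
by apply: decid_ext => t; rewrite -[in RHS](mkseq_nth x (s t)) all_map.
Qed.

End SequenceQuantifiers.

Ltac coded_sort E k :=
  let U := eval simpl in (Equality.sort E) in
  let c := constr:(ltac:(typeclasses eauto) : coded U) in k U c.

Ltac computes_seq := first
  [ match goal with |- @decid ?T ?cT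
        (fun t => in_mem (@?a t) (@mem _ (seq_predType ?E) (@?s t))) =>
      coded_sort E ltac:(fun U c =>
      refine ((@decid_mem T cT E c : forall (f : T -> U) (g : T -> seq U),
        @computable T U cT c f -> @computable T (seq U) cT (@coded_seq U c) g ->
        @decid T cT (fun t => in_mem (f t) (@mem _ (seq_predType E) (g t))))
        a s _ _)) end
  | match goal with |- @decid ?T ?cT (fun t => @prefix ?E (@?a t) (@?b t)) =>
      coded_sort E ltac:(fun U c =>
      refine ((@decid_prefix T cT E c : forall f g : T -> seq U,
        @computable T (seq U) cT (@coded_seq U c) f ->
        @computable T (seq U) cT (@coded_seq U c) g ->
        @decid T cT (fun t => @prefix E (f t) (g t))) a b _ _)) end
  | simple apply computable_take
  | simple apply computable_mkseq
  | match goal with |- decid (fun t => has (@?P t) (@?s t)) =>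
      refine (decid_has_seq (P := P) (s := s) _ _) end
  | match goal with |- decid (fun t => all (@?P t) (@?s t)) =>
      refine (decid_all_seq (P := P) (s := s) _ _) end ].

Ltac computes ::= repeat (first [computes_step | computes_seq]).

Arguments enc : simpl never.
Arguments dec : simpl never.

(** * The universal function *)

(** Arities are forgotten, so different programs may share a code; the length of the argument list
    in a judgment takes the place of the arity. *)
Fixpoint code n (c : rec_scheme n) : nat :=
  match c with
  | RZero _ => npair 0 0
  | RSucc => npair 1 0
  | RProj _ i => npair 2 i
  | RComp m _ f g =>
      npair 3 (npair (code f) (enc [seq code (g i) | i <- enum 'I_m]))
  | RPrec _ f g => npair 4 (npair (code f) (code g))
  | RMin _ f => npair 5 (code f)
  end.

(* [(c, v, y)]: the program with code [c] maps the arguments [v] to [y]. *)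
Notation judgment := (nat * seq nat * nat)%type.

(** The tags follow the constructors of [rec_scheme]. The list [D] occurs only positively, which
    makes [step] monotone in [D]; intermediate values are looked for among the results recorded in
    [D], so every search is finite. *)
Definition rule (D : seq judgment) tag arg (v : seq nat) y :=
  let gs : seq nat := dec (nsnd arg) in
  [|| (tag == 0) && (y == 0),
      (tag == 1) && (y == (head 0 v).+1),
      (tag == 2) && (y == nth 0 v arg),
      (tag == 3) && has (fun j : judgment =>
        [&& j.1.1 == nfst arg, j.2 == y, size j.1.2 == size gs &
            all (fun i => (nth 0 gs i, v, nth 0 j.1.2 i) \in D)
                (iota 0 (size gs))]) D,
      (tag == 4) && (if head 0 v == 0 then (nfst arg, behead v, y) \in D
        else has (fun j : judgment =>
          ((npair tag arg, head 0 v - 1 :: behead v, j.2) \in D) &&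
          ((nsnd arg, [:: head 0 v - 1, j.2 & behead v], y) \in D)) D) |
      (tag == 5) && (((arg, y :: v, 0) \in D) &&
        all (fun k => has (fun j : judgment =>
          (0 < j.2) && ((arg, k :: v, j.2) \in D)) D) (iota 0 y))].

Definition step D (j : judgment) :=
  rule D (nfst j.1.1) (nsnd j.1.1) j.1.2 j.2.

Lemma stepE D tag arg v y : step D (npair tag arg, v, y) = rule D tag arg v y.
Proof. by rewrite /step nfstK nsndK. Qed.

(* Each judgment of a valid list follows from those listed after it. *)
Definition valid (D : seq judgment) :=
  all (fun k => step (drop k.+1 D) (nth (0, [::], 0) D k)) (iota 0 (size D)).

(** Kleene's predicate with an explicit output [y]; the computation coded by [s] is a derivation. *)
Definition T_pred e x y s :=
  let D : seq judgment := dec s in valid D && ((e, [:: x], y) \in D).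

Lemma decid_step (T : Type) {cT : coded T} (f : T -> seq judgment)
    (g : T -> judgment) :
  computable f -> computable g -> decid (fun t => step (f t) (g t)).
Proof. by move=> fR gR; rewrite /step /rule; computes. Qed.

Lemma decid_valid (T : Type) {cT : coded T} (f : T -> seq judgment) :
  computable f -> decid (fun t => valid (f t)).
Proof. by move=> fR; rewrite /valid; computes; refine (decid_step _ _);
  computes. Qed.

Lemma decid_T (T : Type) {cT : coded T} (e x y s : T -> nat) :
  computable e -> computable x -> computable y -> computable s ->
  decid (fun t => T_pred (e t) (x t) (y t) (s t)).
Proof.
move=> eR xR yR sR; rewrite /T_pred; computes.
refine (decid_valid _); computes.
Qed.

Lemma valid_cons j D : valid (j :: D) = step D j && valid D.
Proof.
by rewrite /valid /= drop0 -[1]addn0 iotaDl all_map.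
Qed.

Lemma step_sub D1 D2 j : {subset D1 <= D2} -> step D1 j -> step D2 j.
Proof.
move=> sD; rewrite /step /rule.
have hasD P Q : subpred P Q -> has P D1 -> has Q D2.
  by move=> PQ /hasP [x /sD xD Px]; apply/hasP; exists x => //; apply: PQ.
case/or4P => [H|H|H|H]; apply/or4P;
  [exact: Or41 | exact: Or42 | exact: Or43 | apply: Or44].
case/or3P: H => [/andP [-> H]|/andP [-> H]|/and3P [-> /sD jD /allP H]]; apply/or3P;
  [apply: Or31 | apply: Or32 | apply: Or33] => /=.
- apply: hasD H => j' /and4P [-> -> -> /allP H]; apply/allP => i /H.
  exact: sD.
- move: H; case: ifP => _; first exact: sD.
  by apply: hasD => j' /andP [/sD -> /sD ->].
- rewrite jD; apply/allP => k /H.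
  by apply: hasD => j' /andP [-> /sD ->].
Qed.

Lemma valid_cat D1 D2 : valid D1 -> valid D2 -> valid (D1 ++ D2).
Proof.
elim: D1 => //= j D1 IH; rewrite !valid_cons => /andP [st v1] v2.
rewrite IH // andbT; apply: step_sub st => x; by rewrite mem_cat => ->.
Qed.

(** One inference preserves truth: each case of [rule] supplies the data that the corresponding
    clause of [rec_eval] asks for. *)
Lemma step_sound D :
  (forall n (c : rec_scheme n) (v : n.-tuple nat) y,
    (code c, tval v, y) \in D -> rec_eval c v y) ->
  forall n (c : rec_scheme n) (v : n.-tuple nat) y,
    step D (code c, tval v, y) -> rec_eval c v y.
Proof.
move=> H n [{}n|| {}n i|m {}n f g|{}n f g|{}n f] v y;
  rewrite [code _]/= stepE /rule ?(nfstK, nsndK) /= ?orbF.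
- by move/eqP.
- by move=> /eqP ->; rewrite /thead (tnth_nth 0).
- by move=> /eqP ->; rewrite (tnth_nth 0).
- move=> /hasP [[[cf w] y'] /= jD /and4P [/eqP ? /eqP ? sz /allP al]]; subst cf y'.
  move: sz al; rewrite encK size_map size_enum_ord => sz al.
  exists (Tuple sz); split; last exact (H _ f (Tuple sz) y jD).
  move=> i; have := al i; rewrite mem_iota /= => /(_ (ltn_ord i)).
  rewrite (nth_map i) ?size_enum_ord // nth_ord_enum (tnth_nth 0) => iD.
  exact: H iD.
- case/tupleP: v => -[|k] v /=.
    move=> fD; have := H _ f v y fD => fy.
    exists (fun=> y); split=> //.
    by have -> : [tuple of behead [tuple of 0 :: v]] = v by apply/val_inj.
  rewrite subSS subn0 => /hasP [[[cf w] z] _ /= /andP [zD yD]].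
  have /= [s [s0 sS zE]] := H _ (RPrec f g) [tuple of k :: v] z zD.
  have gy := H _ g [tuple of k :: z :: v] y yD.
  have E : [tuple of behead [tuple of k.+1 :: v]] = v by apply/val_inj.
  have E' : [tuple of behead [tuple of k :: v]] = v by apply/val_inj.
  (* The judgment for [k] yields a sequence of values ending in [z]; the new value [y] is appended
     to it at [k.+1]. *)
  exists (fun i => if i == k.+1 then y else s i).
  rewrite E' /= in s0 sS zE; rewrite E theadE /=; split; rewrite ?eqxx //.
  move=> i le_i; rewrite (ltn_eqF le_i) -[i.+1 == k.+1]/(i == k).
  move: le_i; rewrite ltnS leq_eqVlt => /orP [/eqP->|lt_i].
    by rewrite eqxx; have := gy; rewrite zE; congr rec_eval; apply/val_inj.
  rewrite (ltn_eqF lt_i); have := sS i; rewrite theadE => /(_ lt_i).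
  by congr rec_eval; apply/val_inj.
- move=> /andP [fD /allP al]; split; first exact: H fD.
  move=> k lt_k; have := al k; rewrite mem_iota => /(_ lt_k).
  move=> /hasP [[j' z] _ /= /andP [z0 zD]].
  by exists z.-1; rewrite prednK //; apply: H zD.
Qed.

Lemma valid_sound D : valid D ->
  forall n (c : rec_scheme n) (v : n.-tuple nat) y,
    (code c, tval v, y) \in D -> rec_eval c v y.
Proof.
elim: D => // j D IH; rewrite valid_cons => /andP [st /IH{}IH] n c v y.
by rewrite in_cons => /orP [/eqP E|/IH //]; apply: (step_sound IH); rewrite E.
Qed.

Definition derivable j := exists2 D, valid D & j \in D.

Lemma derivable_all (js : seq judgment) : (forall j, j \in js -> derivable j) ->
  exists2 D, valid D & {subset js <= D}.
Proof.
elim: js => [|j js IH] H; first by exists [::].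
have [D1 v1 jD1] : derivable j by apply: H; rewrite mem_head.
have [|D2 v2 sD2] := IH; first by move=> i ij; apply: H; rewrite in_cons ij orbT.
exists (D1 ++ D2); first exact: valid_cat.
by move=> i; rewrite in_cons mem_cat => /orP [/eqP->|/sD2 ->]; rewrite ?jD1 ?orbT.
Qed.

(** Derivations of the premises are concatenated and the conclusion is put in front, where it may
    refer to all of them. *)
Lemma derivable_step js j :
  (forall i, i \in js -> derivable i) -> step js j -> derivable j.
Proof.
move=> /derivable_all [D vD sD] st; exists (j :: D); last exact: mem_head.
by rewrite valid_cons vD (step_sub sD).
Qed.

(** Induction on the program. Primitive recursion needs a further induction along the intermediate
    values [s i], and minimization one premise for each argument up to [y]. *)
Lemma rec_eval_derivable n (c : rec_scheme n) (v : n.-tuple nat) y :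
  rec_eval c v y -> derivable (code c, tval v, y).
Proof.
elim: c v y => {n} [n||n i|m n f IHf g IHg|n f IHf g IHg|n f IHf] v y /=.
- by move=> ->; apply: (@derivable_step [::]) => //; rewrite stepE /rule.
- move=> ->; apply: (@derivable_step [::]) => //; rewrite stepE /rule /=.
  by rewrite /thead (tnth_nth 0) nth0 eqxx.
- move=> ->; apply: (@derivable_step [::]) => //; rewrite stepE /rule /=.
  by rewrite (tnth_nth 0) eqxx.
- move=> [w [gw fw]].
  pose js := (code f, tval w, y) ::
    [seq (code (g i), tval v, tnth w i) | i <- enum 'I_m].
  apply: (@derivable_step js) => [j|].
    rewrite in_cons => /orP [/eqP->|/mapP [i _ ->]]; first exact: IHf.
    exact: IHg.
  rewrite stepE /rule /js !(nfstK, nsndK) encK /=.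
  rewrite !eqxx size_map size_enum_ord size_tuple eqxx /=.
  apply/orP; left; apply/orP; left; apply/allP => i; rewrite mem_iota /= => lt_i.
  rewrite in_cons; apply/orP; right; apply/mapP; exists (Ordinal lt_i).
    by rewrite mem_enum.
  rewrite (nth_map (Ordinal lt_i)) ?size_enum_ord // (tnth_nth 0).
  by rewrite (nth_ord_enum _ (Ordinal lt_i)).
- move=> [s [s0 sS ->]]; case/tupleP: v s0 sS => k v; rewrite theadE => s0 sS.
  have E i : [tuple of behead [tuple of i :: v]] = v by apply/val_inj.
  rewrite E in s0; suff : forall i, i <= k ->
      derivable (npair 4 (npair (code f) (code g)), i :: v, s i) by apply.
  elim=> [_|i IHi lt_i].
    apply: (@derivable_step [:: (code f, tval v, s 0)]) => [j|].
      by rewrite inE => /eqP->; apply: IHf.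
    by rewrite stepE /rule !(nfstK, nsndK) /= mem_head.
  apply: (@derivable_step [:: (npair 4 (npair (code f) (code g)), i :: v, s i);
      (code g, [:: i, s i & v], s i.+1)]) => [j|].
    rewrite !inE => /orP [/eqP->|/eqP->]; first exact/IHi/ltnW.
    apply: (IHg [tuple of [:: i, s i & v]]).
    by have := sS i lt_i; congr rec_eval; apply/val_inj.
  by rewrite stepE /rule !(nfstK, nsndK) /= subSS subn0 !inE !eqxx ?orbT.
- move=> [f0 fk].
  have /choice [z zP] : forall k, exists z, k < y ->
    rec_eval f [tuple of k :: v] z.+1.
    move=> k; case: (ltnP k y) => [/fk [z fz]|_]; first by exists z.
    by exists 0.
  pose js := (code f, y :: v, 0) :: [seq (code f, k :: v, (z k).+1) | k <- iota 0 y].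
  have jsD j : j \in js -> derivable j.
    rewrite in_cons => /orP [/eqP->|/mapP [k]];
      first exact: (IHf [tuple of y :: v]).
    rewrite mem_iota => /= lt_k ->; exact: (IHf [tuple of k :: v]) (zP _ lt_k).
  have yjs : (code f, y :: tval v, 0) \in js by apply: mem_head.
  have kjs k : k < y -> (code f, k :: tval v, (z k).+1) \in js.
    by move=> lt_k; rewrite in_cons map_f ?orbT // mem_iota.
  clearbody js; apply: (derivable_step jsD).
  have al : all (fun k => has (fun j : judgment =>
      (0 < j.2) && ((code f, k :: tval v, j.2) \in js)) js) (iota 0 y).
    apply/allP => k; rewrite mem_iota /= => /kjs kD.
    by apply/hasP; exists (code f, k :: tval v, (z k).+1).
  by rewrite stepE /rule yjs al.
Qed.

Lemma T_pred_universal f : Rec1 f ->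
  exists e, forall x y, (exists s, T_pred e x y s) <-> f x = y.
Proof.
move=> [c cP]; exists (code c) => x y.
have {cP} := cP [tuple x] y; rewrite (tnth_nth 0) /= => <-; split.
  by move=> [s /andP [vD jD]]; apply: valid_sound vD _ _ _ _ jD.
move=> /rec_eval_derivable [D vD jD]; exists (enc D).
by rewrite /T_pred encK vD.
Qed.

(** Diagonalization: [K] enumerates the [n] such that program [n] maps [n] to 0. A program [e] for
    the characteristic function of this set would output 0 at [e] exactly when [e] is outside the
    set. *)
Lemma halting_undecidable : exists K : nat -> nat -> bool,
  decid (fun p => K p.1 p.2) /\ ~ exists2 P, decid P &
    forall n, P n <-> exists s, K n s.
Proof.
exists (fun n s => T_pred n n 0 s); split; first by apply: decid_T; computes.
move=> [P PR PK].
have [e eP] : exists e, forall x y,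
    (exists s, T_pred e x y s) <-> nat_of_bool (P x) = y.
  exact: T_pred_universal PR.
have := PK e; rewrite eP; case: (P e) => -[H1 H2]; first by have := H1 isT.
by have := H2 erefl.
Qed.

(** * Limits of strings *)

Lemma computable_natrec2 (T U : Type) {cT : coded T} {cU : coded U}
    (f : T -> U) (g : T -> nat -> U -> U) (n : T -> nat) :
    computable f -> computable (fun p => g p.1.1 p.1.2 p.2) -> computable n ->
  computable (fun t => natrec (f t) (g t) (n t)).
Proof. by move=> fR gR nR; have := computable_natrec fR gR nR. Qed.

Lemma computable_half (T : Type) {cT : coded T} (f : T -> nat) :
  computable f -> computable (fun t => (f t)./2).
Proof.
move=> fR; apply: (@computable_min _ _ (fun p => f p.1 <= (p.2 + p.2).+1)).
- by computes.
- by move=> t /=; rewrite -{1}(odd_double_half (f t)) addnn -add1n leq_add2r leq_b1.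
- move=> t k /= lt_k; rewrite -ltnNge addnn -[leqRHS](odd_double_half (f t)).
  by rewrite (leq_trans _ (leq_addl _ _)) // -doubleS leq_double.
Qed.

Section StringLimits.
Implicit Types (w : seq nat) (st : nat -> seq nat).

Definition pstr w : pfun := fun x => if x < size w then Some (nth 0 w x) else None.

Definition increasing_strings st := forall s t, s <= t -> prefix (st s) (st t).

(** The value at [x] is read off at some stage whose string is longer than [x]; for increasing
    strings the chosen stage does not matter. *)
Definition slim st : pfun := fun x =>
  if pselect (exists s, x < size (st s)) is left e
  then Some (nth 0 (st (xchoose e)) x) else None.

Lemma increasing_stringsS st :
  (forall s, prefix (st s) (st s.+1)) -> increasing_strings st.
Proof.
move=> H s t /subnK <-; elim: (t - s) => [|k IH]; first exact: prefix_refl.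
by rewrite addSn; apply: prefix_trans IH (H _).
Qed.

Lemma pstr_prefix w1 w2 x y : prefix w1 w2 -> pstr w1 x = Some y ->
  pstr w2 x = Some y.
Proof.
move=> /prefixP [u ->]; rewrite /pstr; case: ifP => // lt_x [<-].
by rewrite size_cat nth_cat lt_x ltn_addr.
Qed.

Lemma slimP st x y : increasing_strings st ->
  slim st x = Some y <-> exists s, pstr (st s) x = Some y.
Proof.
move=> stI; rewrite /slim; case: pselect => [e|ne]; last first.
  split=> // -[s]; rewrite /pstr; case: ifP => // lt_x _.
  by case: ne; exists s.
have lt_x := xchooseP e; set s := xchoose e in lt_x *.
split=> [[<-]|[t ty]]; first by exists s; rewrite /pstr lt_x.
have : pstr (st s) x = Some (nth 0 (st s) x) by rewrite /pstr lt_x.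
move=> /(pstr_prefix (stI _ _ (leq_maxl s t))).
by rewrite (pstr_prefix (stI _ _ (leq_maxr s t)) ty) => -[->].
Qed.

Lemma pfun_eqP (p q : pfun) : (forall x y, p x = Some y <-> q x = Some y) -> p = q.
Proof.
move=> H; apply/funext => x; case E: (p x) => [y|].
  by apply/esym/H.
by case F: (q x) => [y|] //; move/H: F; rewrite E.
Qed.

Lemma slim_bounded st w : increasing_strings st ->
  (exists s, st s = w) -> (forall s, prefix (st s) w) -> slim st = pstr w.
Proof.
move=> stI [s sw] st_w; apply: pfun_eqP => x y; rewrite slimP //; split.
  by move=> [t]; apply: pstr_prefix.
by move=> wy; exists s; rewrite sw.
Qed.

Lemma pstr_inj : injective pstr.
Proof.
have szE w1 w2 : pstr w1 = pstr w2 -> size w1 <= size w2.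
  move=> /(congr1 (@^~ (size w2))); rewrite /pstr ltnn.
  by case: ltnP.
move=> w1 w2 E; have sz : size w1 = size w2 by apply/eqP; rewrite eqn_leq !szE.
apply: (eq_from_nth (x0 := 0)) => // x lt_x.
by have := congr1 (@^~ x) E; rewrite /pstr -sz lt_x => -[].
Qed.

(** This turns agreement of partial functions below [l] into a decidable comparison of strings.
    Undefinedness counts as well: a string that ends before [l] is matched only by itself. *)
Lemma take_pstr l w1 w2 : take l w1 = take l w2 <->
  forall x, x < l -> pstr w1 x = pstr w2 x.
Proof.
have E w x : x < l -> pstr (take l w) x = pstr w x.
  move=> lt_x; rewrite /pstr size_take_min leq_min lt_x /=; case: ifP => // _.
  by rewrite nth_take.
split=> [H x lt_x|H]; first by rewrite -E // H E.
apply: pstr_inj; apply/funext => x; have [lt_x|le_x] := ltnP x l.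
  by rewrite !E // H.
by rewrite /pstr !size_take_min !leq_min ltnNge le_x.
Qed.

(** Where the limit is defined, one waits for the value; where it is undefined, no stage has a value
    and any start will do. *)
Lemma slim_stable st x : increasing_strings st ->
  exists S, forall t, S <= t -> pstr (st t) x = slim st x.
Proof.
move=> stI; case E: (slim st x) => [y|].
  have [s sy] := (slimP x y stI).1 E.
  by exists s => t /stI /pstr_prefix; apply.
exists 0 => t _; case F: (pstr _ x) => [y|] //.
by have [_ <-] := slimP x y stI; [rewrite E | exists t].
Qed.

Lemma eventually_all (P : nat -> nat -> Prop) l :
  (forall x, x < l -> exists S, forall t, S <= t -> P x t) ->
  exists S, forall t, S <= t -> forall x, x < l -> P x t.
Proof.
elim: l => [|l IH] H; first by exists 0.
have [S1 H1] := IH (fun x lt_x => H x (ltnW lt_x)).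
have [S2 H2] := H l (ltnSn l).
exists (maxn S1 S2) => t; rewrite geq_max => /andP [S1t S2t] x.
by rewrite ltnS leq_eqVlt => /orP [/eqP->|lt_x]; [exact: H2 | exact: H1].
Qed.

Lemma slim_take_stable st l : increasing_strings st ->
  exists S, forall t, S <= t -> forall x, x < l -> pstr (st t) x = slim st x.
Proof. by move=> stI; apply: eventually_all => x _; apply: slim_stable. Qed.

(** If the lengths are unbounded, the limit is total and is computed by searching for a long enough
    stage. Otherwise a stage of maximal length already is the limit, and its length lies in [A]
    unless it is empty. *)
Lemma slim_S1 (A : set nat) st : increasing_strings st -> computable st ->
  (forall s, st s = [::] \/ A (size (st s))) -> S1 A (slim st).
Proof.
move=> stI stR stA.
have [H|H] := pselect (forall x, exists s, x < size (st s)).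
  left; pose f x := nth 0 (st (ex_minn (H x))) x; exists f.
    apply/computableP.
    have sR : computable (fun x => ex_minn (H x)).
      apply: (@computable_min _ _ (fun p => p.1 < size (st p.2))).
      - by computes.
      - by move=> x /=; case: ex_minnP.
      - move=> x k /=; case: ex_minnP => s _ smin lt_k;
          apply: contraL lt_k => /smin.
        by rewrite leqNgt.
    by rewrite /f; computes.
  apply: pfun_eqP => x y; rewrite slimP // /f.
  case: ex_minnP => s lt_x _; have sx : pstr (st s) x = Some (nth 0 (st s) x).
    by rewrite /pstr lt_x.
  split=> [[<-]|[t tx]]; first by exists s.
  have := pstr_prefix (stI _ _ (leq_maxl s t)) sx.
  by rewrite (pstr_prefix (stI _ _ (leq_maxr s t)) tx) => ->.
have /existsNP [x /forallNP xP] := H.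
(* All lengths are at most [x], so a maximal one exists. *)
have [s _ smax] : exists2 s, true & forall t, size (st t) <= size (st s).
  pose Q n := `[< exists s, size (st s) = n >].
  have Qex : exists n, Q n by exists (size (st 0)); apply/asboolP; exists 0.
  have Qle n : Q n -> n <= x by move=> /asboolP [s <-]; rewrite leqNgt;
    apply/negP/xP.
  case: (ex_maxnP Qex Qle) => n /asboolP [s <-] nmax; exists s => // t.
  by apply: nmax; apply/asboolP; exists t.
have limE : slim st = pstr (st s).
  apply: slim_bounded => //; first by exists s.
  move=> t; have [le_st|/ltnW/stI //] := leqP s t.
  have := stI _ _ le_st; move=> /prefixP [u E]; have := smax t; rewrite E size_cat.
  rewrite -{2}[size _]addn0 leq_add2l leqn0 size_eq0 => /eqP->.
  by rewrite cats0 prefix_refl.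
right; have domE : pdom (slim st) = [set x | x < size (st s)].
  rewrite limE; apply/seteqP; split=> z /=; rewrite /pdom /pstr /=.
    by move=> [y]; case: ifP.
  by move=> ->; eexists.
case: (stA s) => [s0|sA]; last by right; exists (size (st s)).
by left; rewrite domE s0; apply/seteqP; split.
Qed.

End StringLimits.

(** * A positive numbering with undecidable equality *)

Ltac computes_main := first
  [ simple apply computable_natrec2
  | simple apply computable_half
  | simple apply decid_T ].

Ltac computes ::= repeat (first [computes_step | computes_seq | computes_main]).

Section Construction.
Variables (A : set nat) (fA : nat -> nat) (K : nat -> nat -> bool).
Hypotheses (fAR : computable fA) (AE : A = range fA)
  (fA_unbounded : forall m, exists k, m < fA k)
  (KR : decid (fun p => K p.1 p.2)).

Lemma decid_K (T : Type) {cT : coded T} (f g : T -> nat) :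
  computable f -> computable g -> decid (fun t => K (f t) (g t)).
Proof. by move=> fR gR; have := computable_comp KR (computable_pair fR gR). Qed.

(** * A sparse sequence of special strings with lengths in [A] *)

Definition next m := fA (ex_minn (fA_unbounded m)).
(** A strictly increasing computable sequence of elements of [A]. Each length belongs to at most one
    special string, so a special string determines its number. *)
Definition len n := iter n next (next 0).

Lemma computable_next : computable next.
Proof.
have minR : computable (fun m => ex_minn (fA_unbounded m)).
  apply: (@computable_min _ _ (fun p => p.1 < fA p.2)).
  - by computes.
  - by move=> m /=; case: ex_minnP.
  - move=> m k /=; case: ex_minnP => s _ smin lt_k; apply: contraL lt_k => /smin.
    by rewrite leqNgt.
by rewrite /next; computes.
Qed.

Lemma computable_len (T : Type) {cT : coded T} (f : T -> nat) :
  computable f -> computable (fun t => len (f t)).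
Proof.
move=> fR; have nR := computable_next.
have gR : computable (fun p : T * nat => next p.2) by computes.
exact: computable_iter (computable_const (next 0)) gR fR.
Qed.

Lemma next_gt m : m < next m.
Proof. by rewrite /next; case: ex_minnP. Qed.

Lemma ltn_len m n : m < n -> len m < len n.
Proof.
elim: n => // n IH; rewrite ltnS leq_eqVlt => /orP [/eqP->|/IH lt_len].
  exact: next_gt.
exact: ltn_trans lt_len (next_gt _).
Qed.

Lemma len_inj : injective len.
Proof.
move=> m n E; case: (ltngtP m n) => // /ltn_len; by rewrite E ltnn.
Qed.

Lemma len_gt n : n < len n.
Proof.
elim: n => [|n IH]; first exact: next_gt.
exact: leq_ltn_trans IH (ltn_len (ltnSn n)).
Qed.

Lemma len_A n : A (len n).
Proof. by rewrite AE; case: n => [|n]; rewrite /len /= /next; eexists. Qed.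

(* [special (2n)] is a proper prefix of [special (2n+1)]; every string is a prefix
   of some [special (2n+1)], since [nsnd] takes each value infinitely often. *)
Definition special m : seq nat := mkseq (nth 0 (dec (nsnd m./2) : seq nat)) (len m).

Lemma computable_special (T : Type) {cT : coded T} (f : T -> nat) :
  computable f -> computable (fun t => special (f t)).
Proof.
move=> fR; rewrite /special; computes.
exact: computable_len.
Qed.

Lemma size_special m : size (special m) = len m.
Proof. exact: size_mkseq. Qed.

Lemma special_inj : injective special.
Proof. by move=> m n /(congr1 size); rewrite !size_special => /len_inj. Qed.

Lemma special_prefix n : prefix (special (n + n)) (special (n + n).+1).
Proof.
rewrite (prefix_nth 0) !size_special (ltnW (ltn_len (ltnSn _))) /=.
apply/allP => x; rewrite mem_iota /= => lt_x; rewrite /special !nth_mkseq //.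
  by rewrite addnn -[n.*2.+1]/(true + n.*2) half_bit_double doubleK.
exact: ltn_trans lt_x (ltn_len (ltnSn _)).
Qed.

(** The search may stop at [size w], because [m < len m = size (special m)]. *)
Definition is_special (w : seq nat) :=
  has (fun m => special m == w) (iota 0 (size w)).

Lemma is_specialP w : reflect (exists m, w = special m) (is_special w).
Proof.
apply: (iffP hasP) => [[m _ /eqP <-]|[m ->]]; exists m => //.
by rewrite mem_iota size_special len_gt.
Qed.

Lemma decid_is_special (T : Type) {cT : coded T} (f : T -> seq nat) :
  computable f -> decid (fun t => is_special (f t)).
Proof.
by move=> fR; rewrite /is_special; computes; refine (computable_special _); computes.
Qed.

Lemma exists_prefix_special (w : seq nat) : exists n, prefix w (special (n + n).+1).
Proof.
(* The second component of the pair makes the entries those of [w]; the first makes the special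
   string at least as long as [w]. *)
exists (npair (size w) (enc w)); set n := npair _ _;
  rewrite (prefix_nth 0) size_special.
have le_w : size w <= len (n + n).+1.
  apply: leq_trans (ltnW (len_gt _)); rewrite ltnW // ltnS.
  exact: leq_trans (npair_ge1 _ _) (leq_addr _ _).
rewrite le_w; apply/allP => x; rewrite mem_iota /= => lt_x.
rewrite /special nth_mkseq; last exact: leq_trans lt_x le_w.
by rewrite addnn -[n.*2.+1]/(true + n.*2) half_bit_double /n nsndK encK.
Qed.

(** Abandoned followers retreat to special strings with odd numbers only. The even number [2n] must
    not be named unless [n] is in the halting set. *)
Definition extension (w : seq nat) := ex_minn (exists_prefix_special w).

Lemma extension_prefix w : prefix w (special (extension w + extension w).+1).
Proof. by rewrite /extension; case: ex_minnP. Qed.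

Lemma computable_extension (T : Type) {cT : coded T} (f : T -> seq nat) :
  computable f -> computable (fun t => extension (f t)).
Proof.
move=> fR; apply: (@computable_min _ _ (fun p =>
  prefix (f p.1) (special (p.2 + p.2).+1))).
- by computes; refine (computable_special _); computes.
- by move=> t; apply: extension_prefix.
- move=> t k /=; rewrite /extension; case: ex_minnP => s _ smin lt_k;
    apply: contraL lt_k => /smin.
  by rewrite leqNgt.
Qed.

(* The stage number is read as a string to be adopted, together with witnesses
   that it is computed by program [nfst i] and that its length lies in [A]. *)
Definition word s := (dec s : seq nat * (seq nat * nat)).1.

(** [nsnd i = 0] sets no bound on the length, while [nsnd i = k.+1] stops at length [k], so that
    programs of total functions also yield finite functions. Special strings are refused, which
    keeps them out of the limits of [alpha]. *)
Definition admissible i s :=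
  let w := word s in
  let d : seq nat * (seq nat * nat) := dec s in
  [&& fA d.2.2 == size w, ~~ is_special w, (nsnd i == 0) || (size w < nsnd i) &
      all (fun x => T_pred (nfst i) x (nth 0 w x) (nth 0 d.2.1 x)) (iota 0 (size w))].

Definition alpha i := natrec [::] (fun s w =>
  if admissible i s && prefix w (word s) then word s else w).

(* [alpha i] has a follower started at stage [s0] that is never abandoned iff
   [last_change i s] tends to [s0]; the limit exists iff no [j < i] has the same
   limit string or function as [i]. *)
Definition change i l s :=
  has (fun j => take l (alpha i s) == take l (alpha j s)) (iota 0 i).

Definition last_change i :=
  natrec 0 (fun s l => if change i l s then s.+1 else l).

Lemma computable_word (T : Type) {cT : coded T} (f : T -> nat) :
  computable f -> computable (fun t => word (f t)).
Proof. by move=> fR; rewrite /word; computes. Qed.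

Lemma decid_admissible (T : Type) {cT : coded T} (f g : T -> nat) :
  computable f -> computable g -> decid (fun t => admissible (f t) (g t)).
Proof.
move=> fR gR; have wR := computable_word gR; have iR := decid_is_special wR.
rewrite /admissible; computes; refine (computable_word _); computes.
Qed.

Lemma computable_alpha (T : Type) {cT : coded T} (f g : T -> nat) :
  computable f -> computable g -> computable (fun t => alpha (f t) (g t)).
Proof.
move=> fR gR; rewrite /alpha; computes.
- by refine (decid_admissible _ _); computes.
- by refine (computable_word _); computes.
- by refine (computable_word _); computes.
Qed.

Lemma computable_last_change (T : Type) {cT : coded T} (f g : T -> nat) :
  computable f -> computable g -> computable (fun t => last_change (f t) (g t)).
Proof.
move=> fR gR; rewrite /last_change /change; computes.
- by refine (computable_alpha _ _); computes.
- by refine (computable_alpha _ _); computes.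
Qed.

Lemma alpha_increasing i : increasing_strings (alpha i).
Proof.
apply: increasing_stringsS => s; rewrite /alpha /=; set w := natrec _ _ s.
by case: ifP => [/andP [] //|_]; apply: prefix_refl.
Qed.

Lemma alpha_A i s : alpha i s = [::] \/ A (size (alpha i s)).
Proof.
elim: s => [|s IH]; first by left.
rewrite /alpha /= -/(alpha i s); case: ifP => // /andP [/and4P [/eqP <- _ _ _] _].
by right; rewrite AE; eexists.
Qed.

Lemma alpha_neq_special i s m : alpha i s <> special m.
Proof.
elim: s => [|s IH]; first by move=> /(congr1 size); rewrite size_special;
  have := len_gt m; case: (len m).
rewrite /alpha /= -/(alpha i s); case: ifP => //;
  move=> /andP [/and4P [_ /is_specialP wP _ _] _] E.
by apply: wP; exists m.
Qed.

(** Late strings agree with the limit on any finite set of arguments, so a special limit would force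
    some [alpha i S] to be that special string. *)
Lemma slim_alpha_neq_special i m : slim (alpha i) <> pstr (special m).
Proof.
move=> E; have [S /(_ S (leqnn S)) H] :=
  (* The position [len m] is included, since there [special m] is undefined and this fixes the
     length of the string. *)
  slim_take_stable (len m).+1 (alpha_increasing i).
rewrite E in H; move/take_pstr: H;
  rewrite (@take_oversize _ _ (special m)) ?size_special // => H.
have := congr1 size H; rewrite size_take_min size_special => sz.
apply: (@alpha_neq_special i S m); rewrite -H take_oversize //.
by move: sz; rewrite /minn; case: ltnP => // _ /eqP; rewrite eqn_leq ltnn.
Qed.

(** * Functions and strings reached by [alpha] *)

Section UniversalIndex.
Variables (e k : nat) (f : nat -> nat).
Hypothesis eP : forall x y, (exists s, T_pred e x y s) <-> f x = y.
Let i := npair e k.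

Lemma alpha_mkseq s : alpha i s = mkseq f (size (alpha i s)).
Proof.
elim: s => // s IH; rewrite /alpha /= -/(alpha i s); case: ifP => // /andP [].
move=> /and4P [_ _ _ /allP H] _; apply: (eq_from_nth (x0 := 0));
  rewrite ?size_mkseq // => x lt_x.
rewrite nth_mkseq //; apply/esym/eP; eexists; have := H x; rewrite /i nfstK.
by apply; rewrite mem_iota.
Qed.

Lemma alpha_size s : k <> 0 -> size (alpha i s) < k.
Proof.
move=> k0; elim: s => [|s IH]; first by rewrite /alpha /=; case: k k0.
rewrite /alpha /= -/(alpha i s); case: ifP => // /andP [/and4P [_ _]].
by rewrite /i nsndK => /orP [/eqP|].
Qed.

(** Some stage [n] codes the word [mkseq f a] with all its witnesses. At that stage the current
    string is either longer already or a prefix of this word, as both are initial segments of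
    [f]. *)
Lemma alpha_reach a : A a -> ~~ is_special (mkseq f a) -> (k == 0) || (a < k) ->
  exists s, a <= size (alpha i s).
Proof.
move=> Aa wP ak; have [u _ uE] : range fA a by rewrite -AE.
have /choice [d dP] : forall x, exists s, T_pred e x (f x) s by move=> x; apply/eP.
pose D : seq nat * (seq nat * nat) := (mkseq f a, (mkseq d a, u)).
have [n nE] : exists n, dec n = D by exists (enc D); rewrite encK.
exists n.+1; rewrite /alpha /= -/(alpha i n) /word nE /=.
have -> : admissible i n.
  rewrite /admissible /word nE /= uE size_mkseq eqxx wP /i nfstK nsndK ak /=.
  by apply/allP => x; rewrite mem_iota /= => lt_x; rewrite !nth_mkseq.
have [le_a|lt_a] := leqP (size (alpha i n)) a; last first.
  by case: ifP => _; [rewrite size_mkseq | exact: ltnW].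
suff -> : prefix (alpha i n) (mkseq f a) by rewrite size_mkseq.
rewrite (prefix_nth 0) size_mkseq le_a; apply/allP => x;
  rewrite mem_iota /= => lt_x.
by rewrite alpha_mkseq !nth_mkseq // (leq_trans lt_x).
Qed.

End UniversalIndex.

Lemma alpha_total f : Rec1 f -> exists i, slim (alpha i) = fun x => Some (f x).
Proof.
move=> /T_pred_universal [e eP]; exists (npair e 0);
  have aI := alpha_increasing (npair e 0).
have key x : exists s, pstr (alpha (npair e 0) s) x = Some (f x).
  (* With this [n], [special (n + n)] starts with [(f 0).+1]. It is the only special string of its
     length, so the initial segment of [f] of that length is not special and can be adopted. *)
  have [n [le_n nE]] : exists n, x <= n /\ dec (nsnd n) = [:: (f 0).+1].
    by exists (npair x (enc [:: (f 0).+1])); rewrite npair_ge1 nsndK encK.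
  have le_x : x < len (n + n).
    by apply: leq_ltn_trans (len_gt _); apply: leq_trans le_n (leq_addr _ _).
  have [|s le_s] := @alpha_reach e 0 f eP (len (n + n)) (len_A _) _ isT.
    apply/is_specialP => -[m E]; have := congr1 size E;
      rewrite size_mkseq size_special => /len_inj mE.
    have b0 : 0 < len (n + n) by apply: leq_ltn_trans (len_gt _).
    have := congr1 (fun w => nth 0 w 0) E;
      rewrite /special -mE !nth_mkseq // addnn doubleK.
    by rewrite nE /= => /eqP; rewrite ltn_eqF.
  have lt_x := leq_trans le_x le_s.
  by exists s; rewrite /pstr lt_x (alpha_mkseq _ eP) nth_mkseq.
apply: pfun_eqP => x y; rewrite slimP //; split; last by move=> <-.
move=> [s sy]; have [t tf] := key x.
rewrite -(pstr_prefix (aI _ _ (leq_maxl s t)) sy).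
by rewrite (pstr_prefix (aI _ _ (leq_maxr s t)) tf).
Qed.

Lemma Rec1_nth w : Rec1 (nth 0 w).
Proof.
exact (computable_nth 0 (computable_id (T := nat)) (computable_const w)).
Qed.

Lemma alpha_string w : w = [::] \/ A (size w) -> ~~ is_special w ->
  exists i, slim (alpha i) = pstr w.
Proof.
move=> wA wP; have [e eP] := T_pred_universal (Rec1_nth w).
(* Program [e] computes the total function [nth 0 w]; the second component prevents growth beyond
   [size w]. *)
exists (npair e (size w).+1); apply: slim_bounded => [||s];
  first exact: alpha_increasing.
  have [s le_s] : exists s, size w <= size (alpha (npair e (size w).+1) s).
    case: wA => [->|wA]; first by exists 0.
    apply: (alpha_reach (k := (size w).+1) eP wA); rewrite ?mkseq_nth /= ?ltnS //.
  exists s; rewrite (alpha_mkseq _ eP) (_ : size _ = size w) ?mkseq_nth //.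
  by apply/eqP; rewrite eqn_leq le_s -ltnS alpha_size.
rewrite (prefix_nth 0) -ltnS alpha_size //=; apply/allP => x;
  rewrite mem_iota /= => lt_x.
by rewrite (alpha_mkseq _ eP) nth_mkseq.
Qed.

(** * Followers that are never abandoned, and least indices of limits *)

Definition live i s0 := forall s, last_change i (s0 + s) = s0.

Lemma last_changeS i s : last_change i s.+1 =
  if change i (last_change i s) s then s.+1 else last_change i s.
Proof. by []. Qed.

(** A change between [t] and [s] would have raised the value above [t]. *)
Lemma last_change_const i s t : last_change i s <= t -> t <= s ->
  last_change i t = last_change i s.
Proof.
elim: s => [|s IH]; first by rewrite leqn0 => _ /eqP->.
rewrite last_changeS; case: ifP => [ch st ts|ch st].
  have -> : t = s.+1 by apply/eqP; rewrite eqn_leq st ts.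
  by rewrite last_changeS ch.
rewrite leq_eqVlt => /orP [/eqP->|/IH ->] //.
by rewrite last_changeS ch.
Qed.

Lemma live_of_stable i l M : (forall t, M <= t -> last_change i t = l) -> live i l.
Proof.
move=> H s; have [/H //|/ltnW le_M] := leqP M (l + s).
by rewrite (@last_change_const i M) ?H // leq_addr.
Qed.

Lemma change_live i s0 : live i s0 -> forall t, s0 <= t -> ~~ change i s0 t.
Proof.
move=> H t /subnKC <-; set s := t - s0; apply/negP => ch.
by have := H s.+1; rewrite addnS last_changeS H ch => /eqP;
  rewrite eqn_leq -addnS -{2}[s0]addn0 leq_add2l.
Qed.

(** If the limits were equal, both strings would agree on the first [s0] places at all late stages,
    and this triggers a change. *)
Lemma live_lim_neq i j s0 : live i s0 -> j < i -> slim (alpha i) <> slim (alpha j).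
Proof.
move=> /change_live H lt_j E.
have [S1 H1] := slim_take_stable s0 (alpha_increasing i).
have [S2 H2] := slim_take_stable s0 (alpha_increasing j).
pose t := maxn s0 (maxn S1 S2).
have /negP := H t (leq_maxl _ _); apply; apply/hasP; exists j;
  first by rewrite mem_iota.
apply/eqP/take_pstr => x lt_x; rewrite H1 ?H2 ?E // /t !leq_max leqnn ?orbT //.
Qed.

Lemma live_unique i j s t : live i s -> live j t ->
  slim (alpha i) = slim (alpha j) -> i = j /\ s = t.
Proof.
move=> Hi Hj E; have ij : i = j.
  case: (ltngtP i j) => // lt_ij; first by case: (live_lim_neq Hj lt_ij).
  by case: (live_lim_neq Hi lt_ij).
(* The value of [last_change] at stage [s + t] is both [s] and [t]. *)
by split=> //; rewrite -(Hi t) addnC ij Hj.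
Qed.

(** Each [j < i] differs from [i] at some argument. Let [M] exceed all these arguments and the
    stages at which both sides have settled there: no change occurs from [M] on once the compared
    length is at least [M]. So either no change occurs after [M], or the first one sets the length
    above [M] and is the last. *)
Lemma live_of_minimal i :
  (forall j, j < i -> slim (alpha j) <> slim (alpha i)) -> exists s0, live i s0.
Proof.
move=> imin.
have [M HM] : exists M, forall l, M <= l -> forall t, M <= t -> ~~ change i l t.
  have /choice [N HN] : forall j, exists N, j < i -> forall l, N <= l ->
    forall t, N <= t ->
      take l (alpha i t) <> take l (alpha j t).
    move=> j; have [lt_j|] := ltnP j i; last by exists 0.
    have [x Nx] : exists x, slim (alpha i) x <> slim (alpha j) x.
      by apply/existsNP => H; apply: (imin _ lt_j); apply/funext.
    have [S1 H1] := slim_stable x (alpha_increasing i).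
    have [S2 H2] := slim_stable x (alpha_increasing j).
    exists (maxn x.+1 (maxn S1 S2)) => _ l; rewrite geq_max => /andP [lt_x _] t.
    rewrite !geq_max => /and3P [_ S1t S2t].
    by move=> /take_pstr /(_ x lt_x); rewrite H1 // H2.
  exists (\max_(j < i) N j) => l le_l t le_t; apply/hasP => -[j];
    rewrite mem_iota /= => lt_j /eqP.
  have le_N := leq_bigmax (F := fun j : 'I_i => N j) (Ordinal lt_j).
  by apply: (HN j lt_j); apply: leq_trans le_N _.
have [[s [le_s ch]]|H] :=
  pselect (exists s, M <= s /\ change i (last_change i s) s).
  exists s.+1; apply: (@live_of_stable _ _ s.+1) => t /subnKC <-.
  elim: (t - s.+1) => [|k IH]; first by rewrite addn0 last_changeS ch.
  rewrite addnS last_changeS IH; case: ifP => // /idPn; case; apply: HM.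
    exact: leqW.
  by apply: leq_trans (leq_addr _ _); apply: leqW.
exists (last_change i M); apply: (@live_of_stable _ _ M) => t /subnKC <-.
elim: (t - M) => [|k IH]; first by rewrite addn0.
rewrite addnS last_changeS; case: ifP => // ch; case: H.
by exists (M + k); rewrite leq_addr.
Qed.

Lemma live_exists i : exists j s0, slim (alpha j) = slim (alpha i) /\ live j s0.
Proof.
have ex : exists j, `[< slim (alpha j) = slim (alpha i) >] 
  by exists i; apply/asboolP.
case: (ex_minnP ex) => j /asboolP jE jmin; exists j.
have [k lt_k E|s0 s0P] := @live_of_minimal j; last by exists s0.
have : j <= k by apply/jmin/asboolP; rewrite E.
by rewrite leqNgt lt_k.
Qed.

(* [event q s] is [0], or [m.+1] when at stage [s] the index [q] is to be
   identified with [special m] for ever.  The index [(0, a)] starts as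
   [special (2a)] and becomes [special (2a+1)] if [a] enters [K]; [(1, (n, t))]
   restores [special (2n)] when [n] has entered [K]; [(2, (i, s0))] follows
   [alpha i] from stage [s0] on until [last_change i] leaves [s0]; every other
   [(_, a)] is [special (2a+1)]. *)
Definition event q s :=
  let a := nsnd q in
  if nfst q == 0 then (if K a s then (a + a).+2 else 0)
  else if nfst q == 1 then
    (if K (nfst a) (nsnd a) then (nfst a + nfst a).+1 else (a + a).+2)
  else if nfst q == 2 then
    (if last_change (nfst a) (nsnd a + s) == nsnd a then 0
     else let n := extension (alpha (nfst a) (nsnd a + s)) in (n + n).+2)
  else (a + a).+2.

Definition unnamed_string q s : seq nat :=
  let a := nsnd q in
  if nfst q == 0 then special (a + a)
  else if nfst q == 2 then alpha (nfst a) (nsnd a + s) else [::].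

Definition name q := natrec 0 (fun s m => if m == 0 then event q s else m).

Definition string q s :=
  if name q s == 0 then unnamed_string q s else special (name q s).-1.

Definition eta q := slim (string q).

Definition named q m := exists s, name q s = m.+1.

Lemma computable_event (T : Type) {cT : coded T} (f g : T -> nat) :
  computable f -> computable g -> computable (fun t => event (f t) (g t)).
Proof.
move=> fR gR; rewrite /event; computes.
- by refine (decid_K _ _); computes.
- by refine (decid_K _ _); computes.
- by refine (computable_last_change _ _); computes.
- by refine (computable_extension _); refine (computable_alpha _ _); computes.
- by refine (computable_extension _); refine (computable_alpha _ _); computes.
Qed.

Lemma computable_name (T : Type) {cT : coded T} (f g : T -> nat) :
  computable f -> computable g -> computable (fun t => name (f t) (g t)).
Proof.
move=> fR gR; rewrite /name; computes.
by refine (computable_event _ _); computes.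
Qed.

Lemma computable_string (T : Type) {cT : coded T} (f g : T -> nat) :
  computable f -> computable g -> computable (fun t => string (f t) (g t)).
Proof.
move=> fR gR; rewrite /string /unnamed_string; computes.
- by refine (computable_name _ _); computes.
- by refine (computable_special _); computes.
- by refine (computable_alpha _ _); computes.
- refine (computable_special _); refine (computable_Rec1 Rec1_pred _).
  by refine (computable_name _ _); computes.
Qed.

(** * Names of indices, and equality under [eta] *)

Lemma nameS q s : name q s.+1 = if name q s == 0 then event q s else name q s.
Proof. by []. Qed.

Lemma name_const q m s t : name q s = m.+1 -> s <= t -> name q t = m.+1.
Proof.
move=> E /subnKC <-; elim: (t - s) => [|k IH]; first by rewrite addn0.
by rewrite addnS nameS IH.
Qed.

Lemma unnamed_prefix q s : prefix (unnamed_string q s) (unnamed_string q s.+1).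
Proof.
rewrite /unnamed_string; case: ifP => _; first exact: prefix_refl.
case: ifP => _ //; rewrite addnS; exact: alpha_increasing.
Qed.

(** Naming an index never retracts output already given; this is why the strings of an index
    increase and [eta] is computable. *)
Lemma event_prefix q s : event q s != 0 ->
  prefix (unnamed_string q s) (special (event q s).-1).
Proof.
rewrite /event /unnamed_string; case: ifP => _.
  by case: ifP => // _ _; apply: special_prefix.
case: ifP => [/eqP->|_]; first by move=> _; apply: prefix0s.
case: ifP => _; last by move=> _; apply: prefix0s.
case: ifP => // _ _; exact: extension_prefix.
Qed.

Lemma string_increasing q : increasing_strings (string q).
Proof.
apply: increasing_stringsS => s; rewrite /string nameS.
case: (name q s == 0) / eqP => [n0|/eqP/negPf n0]; last by rewrite n0 prefix_refl.
by case: eqP => [_|/eqP/event_prefix //]; apply: unnamed_prefix.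
Qed.

Lemma eta_named q m : named q m -> eta q = pstr (special m).
Proof.
move=> [s sm]; apply: slim_bounded => [||t]; first exact: string_increasing.
  by exists s; rewrite /string sm.
have [/string_increasing|/ltnW le_st] := leqP t s.
  by move=> /(_ q); rewrite {2}/string sm.
by rewrite /string (name_const sm le_st) prefix_refl.
Qed.

Lemma eta_unnamed q : (forall s, name q s = 0) -> eta q = slim (unnamed_string q).
Proof. by move=> H; congr slim; apply/funext => s; rewrite /string H. Qed.

Lemma unnamedP q : ~ (exists m, named q m) -> forall s, event q s = 0 /\
  name q s = 0.
Proof.
move=> H; have H0 s : name q s = 0.
  by case E: (name q s) => [//|m]; case: H; exists m, s.
by move=> s; split=> //; have := H0 s.+1; rewrite nameS H0.
Qed.

Lemma named_event q s m : event q s = m.+1 -> exists m, named q m.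
Proof.
move=> E; case: (pselect (exists m, named q m)) => // /unnamedP /(_ s) [].
by rewrite E.
Qed.

Inductive unnamed_spec q : Prop :=
| UnnamedSpecial a of q = npair 0 a & ~ (exists s, K a s) &
  eta q = pstr (special (a + a))
| UnnamedFollower i s0 of q = npair 2 (npair i s0) & live i s0 &
  eta q = slim (alpha i).

Lemma slim_shift st s0 : increasing_strings st ->
  slim (fun s => st (s0 + s)) = slim st.
Proof.
move=> stI; apply: pfun_eqP => x y.
rewrite !slimP //; last by move=> s t le_st; apply: stI; rewrite leq_add2l.
split=> [[s sy]|[s sy]]; first by exists (s0 + s).
by exists s; apply: pstr_prefix sy; apply: stI; apply: leq_addl.
Qed.

Lemma slim_const w : slim (fun=> w) = pstr w.
Proof.
apply: slim_bounded; last by move=> s; apply: prefix_refl.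
- by move=> s t _; apply: prefix_refl.
- by exists 0.
Qed.

Lemma named_or_unnamed q : (exists m, named q m) \/ unnamed_spec q.
Proof.
have [|H] := pselect (exists m, named q m); [by left | right].
have eta_q := eta_unnamed (fun s => (unnamedP H s).2).
have ev s : event q s = 0 := (unnamedP H s).1.
rewrite -(npairK q) in ev eta_q *; move: (nfst q) (nsnd q) ev eta_q =>
  tag a ev eta_q.
move: ev eta_q; rewrite /event /unnamed_string nfstK nsndK.
case: tag => [|[|[|tag]]] /= ev eta_q.
- apply: (@UnnamedSpecial _ a) => //; last by rewrite eta_q slim_const.
  by move=> [s as_]; have := ev s; rewrite as_.
- by have := ev 0; case: ifP.
- apply: (@UnnamedFollower _ (nfst a) (nsnd a)); first by rewrite npairK.
    by move=> s; have := ev s; case: eqP.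
  by rewrite eta_q slim_shift //; apply: alpha_increasing.
- by have := ev 0.
Qed.

(** By parity only tag 1 can give an even number, and it does so only with a witness that [a] has
    entered [K]. *)
Lemma named_even q a : named q (a + a) -> exists s, K a s.
Proof.
move=> [s]; elim: s => // s IH; rewrite nameS; case: eqP => // _.
have par x : x + x = a + a -> x = a by rewrite !addnn => /double_inj.
have odd_even x : (x + x).+2 <> (a + a).+1.
  by move=> /(congr1 odd) /=; rewrite !addnn !odd_double.
rewrite /event; case: ifP => _; first by case: ifP => // _ /odd_even.
case: ifP => _; first by case: ifP => [Ks [] /par <-|_ /odd_even //]; eexists;
  exact: Ks.
by case: ifP => _; [case: ifP => // _ /odd_even | move/odd_even].
Qed.

Lemma unnamed_neq_named q q' m : unnamed_spec q -> named q' m -> eta q <> eta q'.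
Proof.
case=> [a _ nK ->|i s0 _ _ ->] nm; rewrite (eta_named nm).
  by move=> /pstr_inj/special_inj E; apply: nK; apply: (@named_even q'); rewrite E.
exact: slim_alpha_neq_special.
Qed.

(** Names are determined by the function, a named and an unnamed index never agree, and two unnamed
    indices agree only if they coincide: followers by [live_unique], the others by injectivity of
    [special]. Equality thus has a finite witness. *)
Lemma eta_eqP q q' : eta q = eta q' <->
  q = q' \/ exists m, named q m /\ named q' m.
Proof.
split=> [E|[->//|[m [qm q'm]]]]; last by rewrite (eta_named qm) (eta_named q'm).
have [[m qm]|qu] := named_or_unnamed q; have [[m' q'm]|q'u] := named_or_unnamed q'.
- right; exists m; split=> //.
  by have := E; rewrite (eta_named qm) (eta_named q'm) => /pstr_inj/special_inj ->.
- by case: (unnamed_neq_named q'u qm).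
- by case: (unnamed_neq_named qu q'm).
left; move: E; case: qu => [a -> _ ->|i s0 -> Hi ->];
  case: q'u => [a' -> _ ->|i' s0' -> Hi' ->].
- by move=> /pstr_inj/special_inj; rewrite !addnn => /double_inj ->.
- by move/esym/slim_alpha_neq_special.
- by move/slim_alpha_neq_special.
- by move=> /(live_unique Hi Hi') [-> ->].
Qed.

(** * The range of [eta] *)

Lemma string_A q s : string q s = [::] \/ A (size (string q s)).
Proof.
rewrite /string; case: ifP => _; last by right; rewrite size_special; apply: len_A.
rewrite /unnamed_string; case: ifP => _; first by right; rewrite size_special;
  apply: len_A.
by case: ifP => _; [apply: alpha_A | left].
Qed.

Lemma eta_follower i : exists q, eta q = slim (alpha i).
Proof.
have [j [s0 [<- lj]]] := live_exists i; exists (npair 2 (npair j s0)).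
rewrite eta_unnamed => [|s].
  rewrite /unnamed_string !nfstK !nsndK /= nfstK.
  exact: slim_shift (alpha_increasing j).
by elim: s => // s IH; rewrite nameS IH /= /event !(nfstK, nsndK) /= ?nfstK lj eqxx.
Qed.

Lemma named_V n : named (npair 3 n) (n + n).+1.
Proof. by exists 1; rewrite nameS /= /event !(nfstK, nsndK). Qed.

(** Odd numbers are served by tag 3. An even number [2n] keeps its index with tag 0 if [n] never
    enters [K], and otherwise is restored by tag 1. *)
Lemma eta_special m : exists q, eta q = pstr (special m).
Proof.
rewrite -(odd_double_half m); case: (odd m); rewrite -addnn.
  by exists (npair 3 m./2); rewrite (eta_named (named_V _)).
have [[s Ks]|nK] := pselect (exists s, K m./2 s).
  exists (npair 1 (npair m./2 s)); apply: eta_named; exists 1.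
  by rewrite nameS /= /event !(nfstK, nsndK) /= ?(nfstK, nsndK) Ks.
exists (npair 0 m./2); rewrite eta_unnamed.
  by rewrite -(slim_const (special _)) /unnamed_string nfstK nsndK.
elim=> // s IH; rewrite nameS IH /= /event !(nfstK, nsndK) /=.
by case: ifP => // Ks; case: nK; exists s.
Qed.

(** Total functions and strings that are not special are limits of some [alpha i], and a live
    follower of the least such index produces them; special strings have indices of their own. *)
Lemma range_eta : range eta = S1 A.
Proof.
apply/seteqP; split=> [_ [q _ <-]|p].
  apply: slim_S1; [exact: string_increasing | | exact: string_A].
  exact (computable_string (computable_const q) (computable_id (T := nat))).
suff : S1 A p -> exists q, eta q = p by move=> H /H [q <-]; exists q.
case=> [[f fR <-]|pA].
  by have [i <-] := alpha_total fR; apply: eta_follower.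
have [w [wA ->]] : exists w, (w = [::] \/ A (size w)) /\ p = pstr w.
  have none x : ~ pdom p x -> p x = None.
    by move=> H; case E: (p x) => [y|//]; case: H; exists y.
  case: pA => [p0|[a Aa pa]].
    by exists [::]; split; [left | apply/funext => x; apply: none; rewrite p0].
  exists (mkseq (fun x => odflt 0 (p x)) a); rewrite size_mkseq; split;
    first by right.
  apply/funext => x; rewrite /pstr size_mkseq; case: ltnP => [lt_x|le_a].
    have : pdom p x by rewrite pa.
    by move=> [y py]; rewrite nth_mkseq // py.
  by apply: none; rewrite pa /= ltnNge le_a.
have [/is_specialP [m ->]|wP] := boolP (is_special w); first exact: eta_special.
by have [i <-] := alpha_string wA wP; apply: eta_follower.
Qed.

(** * Positivity of [eta] and undecidability of its equality *)

Definition eqv q q' s := (q == q') || (name q s != 0) && (name q s == name q' s).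

(** The stagewise form of [eta_eqP]: names persist, so a common name shows up at one common
    stage. *)
Lemma eqvP q q' : eta q = eta q' <-> exists s, eqv q q' s.
Proof.
rewrite eta_eqP; split=> [[->|[m [[s sm] [t tm]]]]|[s /orP [/eqP->|/andP [n0 /eqP E]]]].
- by exists 0; rewrite /eqv eqxx.
- exists (maxn s t); rewrite /eqv (name_const sm (leq_maxl _ _)).
  by rewrite (name_const tm (leq_maxr _ _)) eqxx orbT.
- by left.
- by right; exists (name q s).-1; split; exists s; rewrite prednK -?E // lt0n.
Qed.

Lemma eqv_mono q q' s t : s <= t -> eqv q q' s -> eqv q q' t.
Proof.
move=> le_st /orP [/eqP->|/andP [n0 /eqP E]]; rewrite /eqv ?eqxx //.
have [m qm] : exists m, name q s = m.+1 by exists (name q s).-1;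
  rewrite prednK // lt0n.
by rewrite (name_const qm le_st) (@name_const q' m s t) ?eqxx ?orbT // -E.
Qed.

Lemma decid_eqv (T : Type) {cT : coded T} (f g h : T -> nat) :
  computable f -> computable g -> computable h ->
  decid (fun t => eqv (f t) (g t) (h t)).
Proof.
move=> fR gR hR; rewrite /eqv; computes; by refine (computable_name _ _); computes.
Qed.

(** The index with tag 3 has the value [special (2n+1)], and the one with tag 0 moves there from
    [special (2n)] exactly when [n] enters [K]. *)
Lemma eta_KP n : (exists s, K n s) <-> eta (npair 0 n) = eta (npair 3 n).
Proof.
split=> [[s Ks]|].
  rewrite (eta_named (named_V n)); apply: eta_named.
  have ev : event (npair 0 n) s = (n + n).+2.
    by rewrite /event !(nfstK, nsndK) /= Ks.
  have [m [t tm]] := named_event ev; have : m = (n + n).+1; last by move=> <-;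
    exists t.
  elim: t tm => // t IH; rewrite nameS; case: eqP => // _.
  by rewrite /event !(nfstK, nsndK) /=; case: ifP => // _ [].
move=> /eta_eqP [/(congr1 nfst)|[m [[s sm] _]]]; first by rewrite !nfstK.
elim: s sm => // s IH; rewrite nameS; case: eqP => // _.
by rewrite /event !(nfstK, nsndK) /=; case: ifP => // Ks _; exists s.
Qed.

(* [p.2] codes indices [k1], [k2] and a stage at which [g k1] and [g k2] are seen
   to be equivalent to the two indices whose equality encodes [p.1] in K. *)
Definition witness (g : nat -> nat) (p : nat * nat) :=
  let d : nat * nat * nat := dec p.2 in
  eqv (g d.1.1) (npair 0 p.1) d.2 && eqv (g d.1.2) (npair 3 p.1) d.2.

(** By surjectivity a search finds [k1] and [k2] such that [g k1] and [g k2] are equivalent to the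
    two indices of [eta_KP]. By injectivity these are equivalent only if [k1 = k2], which is
    decidable. *)
Lemma K_decidable (g : nat -> nat) : computable g -> injective (eta \o g) ->
  range (eta \o g) = S1 A ->
  exists2 D, decid D & forall n, D n <-> exists s, K n s.
Proof.
move=> gR g_inj g_range.
pose Q := witness g.
have Qex n : exists z, Q (n, z).
  have onto q : exists k, eta (g k) = eta q.
    have : S1 A (eta q) by rewrite -range_eta; exists q.
    by rewrite -g_range => -[k _ kE]; exists k.
  have [k1 /eqvP [s1 E1]] := onto (npair 0 n);
    have [k2 /eqvP [s2 E2]] := onto (npair 3 n).
  exists (enc (k1, k2, maxn s1 s2)); rewrite /Q /witness encK /=.
  by rewrite (eqv_mono (leq_maxl _ _) E1) (eqv_mono (leq_maxr _ _) E2).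
have QR : decid Q.
  by rewrite /Q /witness; computes; refine (decid_eqv _ _ _); computes.
have zR : computable (fun n : nat => ex_minn (Qex n)).
  apply: (@computable_min _ _ Q) => // [n|n k]; case: ex_minnP => //.
  by move=> s _ smin; rewrite ltnNge; apply: contra => /smin.
exists (fun n => let d : nat * nat * nat :=
  dec (ex_minn (Qex n)) in d.1.1 == d.1.2).
  by cbv zeta; computes.
move=> n; rewrite eta_KP /=; case: ex_minnP => z /andP [/= E1 E2] _.
have {}E1 : eta (g (dec z : nat * nat * nat).1.1) = eta (npair 0 n) by apply/eqvP;
  eexists; exact: E1.
have {}E2 : eta (g (dec z : nat * nat * nat).1.2) = eta (npair 3 n) by apply/eqvP;
  eexists; exact: E2.
rewrite -E1 -E2; split=> [/eqP e|E]; first by congr (eta (g _)); exact: e.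
by apply/eqP; apply: g_inj; exact: E.
Qed.

End Construction.

Theorem theorem8p16 (pr : nat -> nat -> nat) (hpr : pairing_function pr)
    (A : set nat) (hAinf : infinite_set A) (hAce : ce A) :
  exists eta : nat -> pfun,
    computable_numbering pr (S1 A) eta /\
    positive_numbering pr eta /\
    forall gamma : nat -> pfun,
      friedberg_numbering pr (S1 A) gamma -> ~ m_reducible gamma eta.
Proof.
have [prR _ _] := hpr.
have pR (T : Type) (cT : coded T) (f g : T -> nat) : computable f -> computable g ->
    computable (fun t => pr (f t) (g t)) by exact: computable_Rec2 prR.
have [fA fAR AE] : exists2 f, Rec1 f & A = range f.
  by case: hAce => // A0; case: hAinf; rewrite A0; apply: finite_set0.
(* An infinite set of numbers has elements above every bound. *)
have fA_unb m : exists k, m < fA k.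
  apply: contrapT => H; apply: hAinf; rewrite AE.
  apply: sub_finite_set (finite_II m.+1) => _ [k _ <-] /=.
  by rewrite ltnNge; apply/negP => lt_m; apply: H; exists k.
have [K [KR K_undec]] := halting_undecidable.
pose e := eta K fA_unb; exists e.
have eI q : increasing_strings (string K fA_unb q) by apply: string_increasing.
split; [split; first exact: range_eta | split].
(* The argument codes [(i, x, s, c)]. With [c = 0] the graph point at [x] is listed if stage [s]
   already shows it; in all other cases the padding element [pr (pr i x) 0] is listed. *)
- exists (fun z => let d : nat * nat * nat * nat := dec z in
    let w := string K fA_unb d.1.1.1 d.1.2 in
    if (d.2 == 0) && (d.1.1.2 < size w)
    then pr (pr d.1.1.1 d.1.1.2) (nth 0 w d.1.1.2).+1 else pr (pr d.1.1.1 d.1.1.2) 0).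
    apply/computableP; cbv zeta; computes;
      try (by refine (computable_string _ _ _ _ _); computes);
      refine (pR _ _ _ _ _ _); computes; try (by refine (pR _ _ _ _ _ _); computes).
    by refine (computable_string _ _ _ _ _); computes.
  apply/seteqP; split=> [_ [z _ <-]|z [[i [x ->]]|[i [x [y [/(slimP _ _ (eI i)) [s] + ->]]]]]].
  + have [[[[i x] s] c] <-] : exists d : nat * nat * nat * nat, enc d = z.
      by exists (dec z); rewrite decK.
    rewrite encK /=; case: ifP => [/andP [_ lt_x]|_]; last by left; exists i, x.
    right; exists i, x, (nth 0 (string K fA_unb i s) x); split=> //.
    by apply/(slimP _ _ (eI i)); exists s; rewrite /pstr lt_x.
  + by exists (enc (i, x, 0, 1)); last rewrite encK.
  + rewrite /pstr; case: ifP => // lt_x [<-].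
    by exists (enc (i, x, s, 0)); last rewrite encK /= lt_x.
- rewrite /positive_numbering /ce; right.
  (* The argument codes two indices and a stage; the default [pr 0 0] is harmless, as index 0 equals
     itself. *)
  exists (fun z => let d : nat * nat * nat := dec z in
    if eqv K fA_unb d.1.1 d.1.2 d.2 then pr d.1.1 d.1.2 else pr 0 0).
    apply/computableP; cbv zeta; computes;
      first [by refine (decid_eqv _ _ _ _ _ _);
        computes | refine (pR _ _ _ _ _ _); computes].
  apply/seteqP; split=> [z [i [j [E ->]]]|_ [z _ <-]].
    have [s ijs] := (eqvP K fA_unb i j).1 E.
    by exists (enc (i, j, s)); last rewrite encK /= ijs.
  have [[[i j] s] <-] : exists d : nat * nat * nat, enc d = z.
    by exists (dec z); rewrite decK.
  rewrite encK /=; case: ifP => [ijs|_]; last by exists 0, 0.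
  by exists i, j; split=> //; apply/eqvP; exists s.
- move=> gamma [[g_num _] g_inj] [g gR gE]; apply: K_undec.
  by apply: (@K_decidable A fA K fAR AE fA_unb KR g gR); rewrite -/e -gE.
Qed.
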